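(* There is an algorithm that, given a set $\mathcal{R}$ of rules on a finite ground set $Q$ and a subset $X\subseteq Q$, decides whether $X\in\mathcal{A}(\mathcal{R})$ in linear time, i.e. in time $O(l(\mathcal{R}))$.
   Context: A rule (Horn rule) on $Q$ is a pair $(A,q)$ with $A\subseteq Q$ and $q\in Q$. The rule $(A,q)$ accepts a set $X\subseteq Q$ if $q\in X$ implies $X\cap A\neq\emptyset$. For a set $\mathcal{R}$ of rules, $\mathcal{K}(\mathcal{R})$ is the family of subsets of $Q$ accepted by all rules of $\mathcal{R}$ (it is union-closed and contains $\emptyset$). A tight path from $\emptyset$ to $X$ in a family $\mathcal{K}$ is a sequence $\emptyset=Y_0\subseteq Y_1\subseteq\dots\subseteq Y_k=X$ of members of $\mathcal{K}$ with $|Y_{i+1}\setminus Y_i|=1$. $\mathcal{A}(\mathcal{R})$ is the family of all $K\in\mathcal{K}(\mathcal{R})$ for which there is a tight path from $\emptyset$ to $K$ in $\mathcal{K}(\mathcal{R})$ (it is the unique maximal antimatroid contained in $\mathcal{K}(\mathcal{R})$, where an antimatroid is a union-closed family in which every nonempty member $X$ has some $x\in X$ with $X\setminus\{x\}$ a member). The input size is $l(\mathcal{R})=\sum_{(A,q)\in\mathcal{R}}(|A|+1)$, and it is assumed that $l(\mathcal{R})\ge |Q|$. *)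

(* Defs.v *)
From mathcomp Require Import all_boot.
Set Implicit Arguments. Unset Strict Implicit. Unset Printing Implicit Defensive.

Definition rule (n : nat) : Type := ({set 'I_n} * 'I_n)%type.

Definition accepts n (r : rule n) (X : {set 'I_n}) : bool :=
  (r.2 \in X) ==> (X :&: r.1 != set0).

Definition inK n (R : seq (rule n)) (X : {set 'I_n}) : bool :=
  all (fun r => accepts r X) R.

Definition tight_step n (Y Z : {set 'I_n}) : bool :=
  (Y \subset Z) && (#|Z :\: Y| == 1).

Definition tight_path_to n (R : seq (rule n)) (X : {set 'I_n}) : Prop :=
  exists s : seq {set 'I_n},
    [/\ inK R set0, all (inK R) s, path (@tight_step n) set0 s
      & last set0 s = X].

Definition inA n (R : seq (rule n)) (X : {set 'I_n}) : Prop :=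
  inK R X /\ tight_path_to R X.

Definition lsize n (R : seq (rule n)) : nat :=
  \sum_(r <- R) (#|r.1| + 1).

(* Machine model: unit-cost RAM with unbounded natural-number          *)
(* registers, indirect addressing, addition and truncated subtraction. *)

Inductive instr : Type :=
| IConst (d c : nat)
| IAdd   (d a b : nat)
| ISub   (d a b : nat)
| ILoad  (d a : nat)
| IStore (a s : nat)
| IJz    (a l : nat)
| IJmp   (l : nat)
| IHalt.

Definition program := seq instr.

Record state := State { pc : nat; mem : nat -> nat }.

Definition upd (m : nat -> nat) (a v : nat) : nat -> nat :=
  fun x => if x == a then v else m x.

(* Fetch: executing past the end of the program counts as halting. *)
Definition fetch (p : program) (i : nat) : instr := nth IHalt p i.

Definition step (p : program) (s : state) : state :=
  let m := mem s in
  let i := pc s in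
  match fetch p i with
  | IConst d c => State i.+1 (upd m d c)
  | IAdd d a b => State i.+1 (upd m d (m a + m b))
  | ISub d a b => State i.+1 (upd m d (m a - m b))
  | ILoad d a => State i.+1 (upd m d (m (m a)))
  | IStore a s' => State i.+1 (upd m (m a) (m s'))
  | IJz a l => State (if m a == 0 then l else i.+1) m
  | IJmp l => State l m
  | IHalt => s
  end.

Definition halted (p : program) (s : state) : bool :=
  if fetch p (pc s) is IHalt then true else false.

Definition exec (p : program) (k : nat) (s : state) : state :=
  iter k (step p) s.

Definition init_state (w : seq nat) : state :=
  State 0 (fun x => nth 0 w x).

Definition runs_in (p : program) (w : seq nat) (k : nat) (b : bool) : Prop :=
  let s := exec p k (init_state w) in
  halted p s /\ ((mem s 0 == 1) = b).

Definition enc_set n (A : {set 'I_n}) : seq nat := [seq val x | x <- enum A].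

Definition enc_rule n (r : rule n) : seq nat :=
  [:: #|r.1|, val r.2 & enc_set r.1].

Definition encode n (R : seq (rule n)) (X : {set 'I_n}) : seq nat :=
  [:: n, size R & flatten (map (@enc_rule n) R)] ++ (#|X| :: enc_set X).

(* Main.v *)
Require Import Defs.
From mathcomp Require Import all_boot.
From mathcomp Require Import zify.
Set Implicit Arguments. Unset Strict Implicit. Unset Printing Implicit Defensive.

(** Starting from Y = set0, add elements x of X to Y as long as Y + x is
accepted by all rules, i.e. as long as every rule (A, x) satisfies x \in A or
meets Y. This condition is monotone in Y, so the greedy procedure ends with the
largest member of A(R) inside X, and X is in A(R) iff everything was added. As
in unit propagation, each x carries the number of its unsatisfied rules, and
every element the linked list of the rules whose body contains it; each
occurrence is visited at most once, hence linear time.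

The machine has no free register at the start, since the input fills the low
cells. The size of the ground set is redundant, so cell 0 can receive the
constant 1; three more cells are freed by Cantor pairing, in linear time by
unary loops. A pointer then runs through memory until it has seen more zeros
than the input can contain, so that it is beyond the input; its value B serves
as stride: array k occupies the addresses k B + j with j < B, and the input
moves to array 1.

Correctness is proved for structured programs with a cost semantics, where loops
carry an invariant indexed by a potential that pays for the running time. *)

(** * Structured programs with cost *)

Inductive com (op : Type) : Type :=
| Skip
| Op (o : op)
| Seq (c d : com op)
| If (a : nat) (c d : com op)
| While (a : nat) (c : com op).
Arguments Skip {op}.

(** One program logic serves two languages: RAM instructions on raw memory, and operations on
    registers and arrays. *)
Record lang := Lang {
  op : Type;
  st : Type;
  rd : st -> nat -> nat;
  pre : op -> st -> Prop;
  eff : op -> st -> st }.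

(** The costs are exactly those of the compiled code: a nonzero test also pays for the jump over the
    other branch or back to the loop head. *)
Inductive ev (l : lang) : com (op l) -> st l -> st l -> nat -> Prop :=
| ev_skip s : ev Skip s s 0
| ev_op o s : pre o s -> ev (Op o) s (eff o s) 1
| ev_seq c d s s1 s2 t1 t2 :
    ev c s s1 t1 -> ev d s1 s2 t2 -> ev (Seq c d) s s2 (t1 + t2)
| ev_if_nz a c d s s1 t :
    rd s a != 0 -> ev c s s1 t -> ev (If a c d) s s1 t.+2
| ev_if_z a c d s s1 t :
    rd s a = 0 -> ev d s s1 t -> ev (If a c d) s s1 t.+1
| ev_while_z a c s : rd s a = 0 -> ev (While a c) s s 1
| ev_while_nz a c s s1 s2 t1 t2 :
    rd s a != 0 -> ev c s s1 t1 -> ev (While a c) s1 s2 t2 ->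
    ev (While a c) s s2 (t1 + t2).+2.

Definition wp l (c : com (op l)) s (Q : st l -> nat -> Prop) : Prop :=
  exists s1 t, ev c s s1 t /\ Q s1 t.

(** Straight code and branches are computed away; loops stay as [wp], to be settled by an
    invariant. *)
Fixpoint vc l (c : com (op l)) s (Q : st l -> nat -> Prop) : Prop :=
  match c with
  | Skip => Q s 0
  | Op o => pre o s /\ Q (eff o s) 1
  | Seq c d => vc c s (fun s1 t1 => vc d s1 (fun s2 t2 => Q s2 (t1 + t2)))
  | If a c d => if rd s a == 0 then vc d s (fun s1 t => Q s1 t.+1)
                else vc c s (fun s1 t => Q s1 t.+2)
  | While a c => wp (While a c) s Q
  end.

Lemma vc_wp l (c : com (op l)) s Q : vc c s Q -> wp c s Q.
Proof.
elim: c s Q => [|o|c IHc d IHd|a c IHc d IHd|a c IHc] s Q //=.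
- by move=> HQ; exists s, 0; split=> //; constructor.
- by case=> ho HQ; exists (eff o s), 1; split=> //; constructor.
- case/IHc=> s1 [t1 [e1 /IHd [s2 [t2 [e2 HQ]]]]].
  by exists s2, (t1 + t2); split=> //; apply: ev_seq e1 e2.
- case: eqP => [z|/eqP nz].
    case/IHd=> s1 [t [e HQ]]; exists s1, t.+1; split=> //; exact: ev_if_z.
  case/IHc=> s1 [t [e HQ]]; exists s1, t.+2; split=> //; exact: ev_if_nz.
Qed.

(** The index of the invariant bounds the time still needed, so strong induction on it also gives
    termination. Each round pays 2 for test and jump; the last test is the successor in [phi.+1]. *)
Lemma wp_while l (I : nat -> st l -> Prop) a (c : com (op l)) Q phi s :
  (forall f s, I f s -> rd s a != 0 ->
     vc c s (fun s1 t => exists2 f1, I f1 s1 & t + 2 + f1 <= f)) ->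
  I phi s ->
  (forall f s1 t, I f s1 -> rd s1 a = 0 -> t <= phi.+1 -> Q s1 t) ->
  wp (While a c) s Q.
Proof.
move=> body Is post.
have [f1 [s1 [t [e If1 z le_t]]]] : exists f s1 t,
    [/\ ev (While a c) s s1 t, I f s1, rd s1 a = 0 & t <= phi.+1].
  elim/ltn_ind: phi s Is {post} => phi IH s Is.
  have [z|/eqP nz] := eqVneq (rd s a) 0.
    by exists phi, s, 1; split=> //; apply: ev_while_z.
  have /vc_wp [s1 [t1 [e1 [f1 I1 le1]]]] := body _ _ Is (introN eqP nz).
  have [|f2 [s2 [t2 [e2 I2 z le2]]]] := IH f1 _ s1 I1; first by lia.
  exists f2, s2, (t1 + t2).+2; split=> //; last by lia.
  by apply: ev_while_nz e1 e2; apply/eqP.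
by exists s1, t; split=> //; apply: (post f1).
Qed.

Lemma wp_mono l (c : com (op l)) s (Q Q' : st l -> nat -> Prop) :
  (forall s t, Q s t -> Q' s t) -> wp c s Q -> wp c s Q'.
Proof. by move=> sub [s1 [t [e HQ]]]; exists s1, t; split=> //; apply: sub. Qed.

Lemma wp_seq l (c d : com (op l)) s (Q : st l -> nat -> Prop) :
  wp c s (fun s1 t1 => wp d s1 (fun s2 t2 => Q s2 (t1 + t2))) ->
  wp (Seq c d) s Q.
Proof.
case=> s1 [t1 [e1 [s2 [t2 [e2 HQ]]]]].
by exists s2, (t1 + t2); split=> //; apply: ev_seq e1 e2.
Qed.

Lemma wp_last l (c : com (op l)) s (Q : st l -> nat -> Prop) :
  wp c s Q -> wp (Seq c Skip) s Q.
Proof.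
move=> h; apply: wp_seq; apply: wp_mono h => s1 t HQ.
by exists s1, 0; split; [constructor | rewrite addn0].
Qed.

Definition block op (cs : seq (com op)) : com op := foldr (@Seq op) Skip cs.

(** * Compilation to the RAM *)

Definition ram_eff (i : instr) (m : nat -> nat) : nat -> nat :=
  match i with
  | IConst d c => upd m d c
  | IAdd d a b => upd m d (m a + m b)
  | ISub d a b => upd m d (m a - m b)
  | ILoad d a => upd m d (m (m a))
  | IStore a s => upd m (m a) (m s)
  | _ => m
  end.

Definition straight (i : instr) : bool :=
  match i with IJz _ _ | IJmp _ | IHalt => false | _ => true end.

Definition ram : lang :=
  Lang (fun (m : nat -> nat) a => m a) (fun i _ => straight i) ram_eff.

(** Jump targets are absolute, hence the parameter [o], the address where the code is placed. *)
Fixpoint compile (o : nat) (c : com instr) : program :=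
  match c with
  | Skip => [::]
  | Op i => [:: i]
  | Seq c d => compile o c ++ compile (o + size (compile o c)) d
  | If a c d =>
      let pc := compile o.+1 c in
      let od := o.+1 + (size pc).+1 in
      let pd := compile od d in
      IJz a od :: (pc ++ IJmp (od + size pd) :: pd)
  | While a c =>
      let pc := compile o.+1 c in
      IJz a (o.+1 + (size pc).+1) :: (pc ++ [:: IJmp o])
  end.

Definition code_at (p : program) (o : nat) (l : program) : Prop :=
  forall i, i < size l -> fetch p (o + i) = nth IHalt l i.

Lemma code_at_cat p o l1 l2 :
  code_at p o (l1 ++ l2) -> code_at p o l1 /\ code_at p (o + size l1) l2.
Proof.
move=> H; split=> i lt_i.
  by rewrite H ?size_cat ?nth_cat ?lt_i //; lia.
rewrite -addnA H ?size_cat; last by lia.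
by rewrite nth_cat ifF; [rewrite addKn | lia].
Qed.

Lemma code_at_cons p o i l :
  code_at p o (i :: l) -> fetch p o = i /\ code_at p o.+1 l.
Proof.
move=> H; split; first by rewrite -[o]addn0 H.
by move=> j lt_j; rewrite addSnnS H.
Qed.

Lemma exec_add p t1 t2 s : exec p (t1 + t2) s = exec p t2 (exec p t1 s).
Proof. by rewrite /exec addnC iterD. Qed.

Lemma execS p t s : exec p t.+1 s = exec p t (step p s).
Proof. exact: iterSr. Qed.

Arguments exec : simpl never.

Lemma compile_correct p c m m1 t : ev (l := ram) c m m1 t ->
  forall o, code_at p o (compile o c) ->
  exec p t (State o m) = State (o + size (compile o c)) m1.
Proof.
have jmp o l m0 : fetch p o = IJmp l -> step p (State o m0) = State l m0.
  by rewrite /step /= => ->.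
have jz o a l (m0 : nat -> nat) : fetch p o = IJz a l ->
    step p (State o m0) = State (if m0 a == 0 then l else o.+1) m0.
  by rewrite /step /= => ->.
elim=> {c m m1 t} [s|i s si|c d s s1 s2 t1 t2 _ IH1 _ IH2|a c d s s1 t /= nz _ IH
  |a c d s s1 t /= z _ IH|a c s /= z|a c s s1 s2 t1 t2 /= nz _ IH1 _ IH2] o.
- by rewrite addn0.
- move=> /code_at_cons [fi _].
  by rewrite /= addn1 /exec /= /step /= fi; case: i si {fi}.
- move=> /code_at_cat [h1 h2].
  by rewrite /= exec_add IH1 // IH2 // size_cat addnA.
- move=> /code_at_cons [fj /code_at_cat [h1 /code_at_cons [fj2 h2]]].
  rewrite execS (jz _ _ _ _ fj) (negbTE nz) -(addn1 t) exec_add IH //.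
  rewrite execS (jmp _ _ _ fj2); congr State.
  by rewrite /= size_cat /=; lia.
- move=> /code_at_cons [fj /code_at_cat [h1 /code_at_cons [fj2 h2]]].
  rewrite execS (jz _ _ _ _ fj) z eqxx IH; last by rewrite -addnS in h2.
  by congr State; rewrite /= size_cat /=; lia.
- move=> /code_at_cons [fj _].
  rewrite execS (jz _ _ _ _ fj) z eqxx; congr State.
  by rewrite /= size_cat /=; lia.
move=> h; have [fj /code_at_cat [h1 /code_at_cons [fj2 _]]] := code_at_cons h.
rewrite execS (jz _ _ _ _ fj) (negbTE nz) -(addnS t1) exec_add IH1 //.
by rewrite execS (jmp _ _ _ fj2) IH2.
Qed.

(** Execution ends just past the code, where [fetch] returns its default [IHalt]. *)
Lemma compile_halts c m m1 t : ev (l := ram) c m m1 t ->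
  let s := exec (compile 0 c) t (State 0 m) in halted (compile 0 c) s /\ Defs.mem s = m1.
Proof.
move=> e /=; rewrite (compile_correct e) //= /halted /fetch /=.
by rewrite nth_default.
Qed.

(** * A machine with registers and arrays *)

Inductive aop : Type :=
| AConst (d c : nat)
| AAdd (d a b : nat)
| ASub (d a b : nat)
| ALoad (d k i : nat)
| AStore (k i s : nat).

Definition ast : Type := ((nat -> nat) * (nat -> nat -> nat))%type.

Definition updA (A : nat -> nat -> nat) k j v : nat -> nat -> nat :=
  fun k1 => if k1 == k then upd (A k) j v else A k1.

(* Cells 4 and 5 hold the array stride and the address being computed. *)
Definition is_reg (i : nat) : bool := [&& i < 32, i != 4 & i != 5].
Definition is_arr (k : nat) : bool := 0 < k < 10.

Definition arr_pre (B : nat) (o : aop) (s : ast) : Prop :=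
  match o with
  | AConst d _ => is_reg d
  | AAdd d a b | ASub d a b => [&& is_reg d, is_reg a & is_reg b]
  | ALoad d k i => [&& is_reg d, is_arr k & is_reg i] /\ s.1 i < B
  | AStore k i r => [&& is_arr k, is_reg i & is_reg r] /\ s.1 i < B
  end.

Definition arr_eff (o : aop) (s : ast) : ast :=
  match o with
  | AConst d c => (upd s.1 d c, s.2)
  | AAdd d a b => (upd s.1 d (s.1 a + s.1 b), s.2)
  | ASub d a b => (upd s.1 d (s.1 a - s.1 b), s.2)
  | ALoad d k i => (upd s.1 d (s.2 k (s.1 i)), s.2)
  | AStore k i r => (s.1, updA s.2 k (s.1 i) (s.1 r))
  end.

Definition arrm (B : nat) : lang :=
  Lang (fun (s : ast) a => s.1 a) (arr_pre B) arr_eff.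

(** In place of a multiplication, the stride in cell 4 is added [k] times; [k] is fixed in the
    program text, so this takes constant time. *)
Fixpoint addr (k i : nat) : com instr :=
  if k is k1.+1 then Seq (addr k1 i) (Op (IAdd 5 5 4))
  else block [:: Op (IConst 5 0); Op (IAdd 5 5 i)].

Definition ram_of (o : aop) : com instr :=
  match o with
  | AConst d c => Op (IConst d c)
  | AAdd d a b => Op (IAdd d a b)
  | ASub d a b => Op (ISub d a b)
  | ALoad d k i => Seq (addr k i) (Op (ILoad d 5))
  | AStore k i r => Seq (addr k i) (Op (IStore 5 r))
  end.

Fixpoint guards (op : Type) (c : com op) : seq nat :=
  match c with
  | Skip | Op _ => [::]
  | Seq c d => guards c ++ guards d
  | If a c d => a :: guards c ++ guards d
  | While a c => a :: guards c
  end.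

Fixpoint cmap (c : com aop) : com instr :=
  match c with
  | Skip => Skip
  | Op o => ram_of o
  | Seq c d => Seq (cmap c) (cmap d)
  | If a c d => If a (cmap c) (cmap d)
  | While a c => While a (cmap c)
  end.

Definition rep (B : nat) (s : ast) (m : nat -> nat) : Prop :=
  [/\ forall i, is_reg i -> m i = s.1 i,
      m 4 = B
    & forall k j, is_arr k -> j < B -> m (k * B + j) = s.2 k j].

Lemma rep_reg B s m i : rep B s m -> is_reg i -> m i = s.1 i.
Proof. by case=> hr _ _ /hr. Qed.

Lemma addr_spec k i m : is_reg i -> exists m1,
  [/\ ev (l := ram) (addr k i) m m1 (k + 2), m1 5 = k * m 4 + m i
    & forall x, x != 5 -> m1 x = m x].
Proof.
move=> ri; have i5 : (i == 5) = false by case/and3P: ri => _ _ /negbTE.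
elim: k => [|k [m1 [e m15 m1x]]] /=.
  exists (upd (upd m 5 0) 5 (0 + m i)); split=> [||x /negbTE x5] //.
    apply: (@ev_seq ram _ _ _ (upd m 5 0) _ 1 1); first exact: (@ev_op ram).
    have -> : upd (upd m 5 0) 5 (0 + m i) = ram_eff (IAdd 5 5 i) (upd m 5 0).
      by congr upd; rewrite /upd i5.
    by apply: (@ev_seq ram _ _ _ _ _ 1 0); [apply: (@ev_op ram) | constructor].
  by rewrite /upd x5.
exists (upd m1 5 (m1 5 + m1 4)); split.
- have -> : k.+1 + 2 = k + 2 + 1 by lia.
  by apply: ev_seq e _; apply: (@ev_op ram).
- by rewrite {1}/upd /= m15 m1x //; lia.
by move=> x x5; rewrite /upd (negbTE x5) m1x.
Qed.

(** Registers lie below 32 and arrays from [B] on, so neither disturbs the other. As [k] is at most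
    9, an address costs at most 11 steps and the access one more. *)
Lemma ram_of_spec B o s m : 32 <= B -> arr_pre B o s -> rep B s m ->
  exists m1 t, [/\ ev (l := ram) (ram_of o) m m1 t, rep B (arr_eff o s) m1
    & t <= 12].
Proof.
move=> B32.
have arr_big k j : is_arr k -> B <= k * B + j by rewrite /is_arr; nia.
have reg_upd s1 m1 d v : rep B s1 m1 -> is_reg d ->
    rep B (upd s1.1 d v, s1.2) (upd m1 d v).
  move=> [hr h4 ha] rd; split=> [i ri||k j rk lt_j] /=; rewrite /upd.
  - by rewrite hr.
  - by case: eqP => // e4; move: rd; rewrite -e4.
  - case: eqP => [e|_]; last exact: ha.
    by have := arr_big k j rk; move: rd; rewrite /is_reg; lia.
have rep5 s1 m1 m2 : rep B s1 m1 -> (forall x, x != 5 -> m2 x = m1 x) ->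
    rep B s1 m2.
  move=> [hr h4 ha] h; split=> [i ri||k j rk lt_j].
  - by rewrite h ?hr //; case/and3P: ri.
  - by rewrite h.
  - by rewrite h ?ha //; have := arr_big k j rk; lia.
case: o => [d c|d a b|d a b|d k i|k i r] /=.
- by move=> rd rm; exists (upd m d c), 1; split=> //;
    [apply: (@ev_op ram) | apply: reg_upd].
- move=> /and3P [rd ra rb] rm; have [hr _ _] := rm.
  exists (upd m d (m a + m b)), 1; split=> //; first exact: (@ev_op ram).
  by rewrite !hr //; apply: reg_upd.
- move=> /and3P [rd ra rb] rm; have [hr _ _] := rm.
  exists (upd m d (m a - m b)), 1; split=> //; first exact: (@ev_op ram).
  by rewrite !hr //; apply: reg_upd.
- move=> [/and3P [rd rk ri] lt_i] rm; have [hr h4 ha] := rm.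
  have [m1 [e m15 m1x]] := addr_spec k m ri.
  exists (upd m1 d (m1 (m1 5))), (k + 2 + 1); split.
  + by apply: ev_seq e _; apply: (@ev_op ram).
  + rewrite m15 h4 hr // m1x ?ha //; last by have := arr_big k (s.1 i) rk; lia.
    by apply: reg_upd => //; apply: rep5 rm _.
  + by move: rk; rewrite /is_arr; lia.
move=> [/and3P [rk ri rr] lt_i] rm; have [hr h4 ha] := rm.
have [m1 [e m15 m1x]] := addr_spec k m ri.
exists (upd m1 (m1 5) (m1 r)), (k + 2 + 1); split.
- by apply: ev_seq e _; apply: (@ev_op ram).
- rewrite m15 h4 hr //.
  have -> : m1 r = s.1 r by rewrite m1x ?hr //; case/and3P: rr.
  have [hr1 h41 ha1] := rep5 _ _ _ rm m1x.
  have big := arr_big k (s.1 i) rk.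
  split=> [x rx||k1 j rk1 lt_j]; rewrite /upd /=.
  + by rewrite hr1 // ifF //; move: rx; rewrite /is_reg; lia.
  + by rewrite h41 ifF //; lia.
  + rewrite /updA; case: (eqVneq k1 k) => [-> | nk].
      by rewrite eqn_add2l /upd; case: eqP => // _; rewrite ha1.
    (* Different arrays share no address, because both offsets are below the stride. *)
    rewrite ha1 // ifF //; apply/negbTE/eqP => eq_addr.
    move: nk; rewrite neq_ltn => /orP [] lt_k;
      have := leq_mul lt_k (leqnn B); rewrite mulSn; lia.
- by move: rk; rewrite /is_arr; lia.
Qed.

Lemma cmap_spec B c s s1 t : 32 <= B -> ev (l := arrm B) c s s1 t ->
  all is_reg (guards c) -> forall m, rep B s m -> exists m1 t1,
  [/\ ev (l := ram) (cmap c) m m1 t1, rep B s1 m1 & t1 <= 12 * t].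
Proof.
move=> B32; elim=> {c s s1 t} /=.
- by move=> s _ m rm; exists m, 0; split=> //; constructor.
- move=> o s po _ m rm.
  by have [m1 [t [e r1 le_t]]] := ram_of_spec B32 po rm; exists m1, t.
- move=> c d s s1 s2 t1 t2 _ IH1 _ IH2; rewrite all_cat => /andP [g1 g2] m rm.
  have [m1 [u1 [e1 r1 le1]]] := IH1 g1 m rm.
  have [m2 [u2 [e2 r2 le2]]] := IH2 g2 m1 r1.
  by exists m2, (u1 + u2); split=> //; [apply: ev_seq e1 e2 | lia].
- move=> a c d s s1 t nz _ IH; rewrite all_cat => /and3P [ga g1 g2] m rm.
  have [m1 [u1 [e1 r1 le1]]] := IH g1 m rm.
  exists m1, u1.+2; split=> //; last by lia.
  by apply: (ev_if_nz (l := ram)) e1; rewrite /= (rep_reg rm).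
- move=> a c d s s1 t z _ IH; rewrite all_cat => /and3P [ga g1 g2] m rm.
  have [m1 [u1 [e1 r1 le1]]] := IH g2 m rm.
  exists m1, u1.+1; split=> //; last by lia.
  by apply: (ev_if_z (l := ram)) e1; rewrite /= (rep_reg rm).
- move=> a c s z /andP [ga gc] m rm; exists m, 1; split=> //.
  by apply: (ev_while_z (l := ram)); rewrite /= (rep_reg rm).
- move=> a c s s1 s2 t1 t2 nz _ IH1 _ IH2 g m rm.
  have /andP [ga gc] := g.
  have [m1 [u1 [e1 r1 le1]]] := IH1 gc m rm.
  have [m2 [u2 [e2 r2 le2]]] := IH2 g m1 r1.
  exists m2, (u1 + u2).+2; split=> //; last by lia.
  by apply: (ev_while_nz (l := ram)) e1 e2; rewrite /= (rep_reg rm).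
Qed.

(** * Relocating the input *)

Fixpoint tri (n : nat) : nat := if n is n1.+1 then n + tri n1 else 0.

Lemma tri_le m n : m <= n -> tri m <= tri n.
Proof.
elim: n m => [|n IH] [|m] //=; rewrite ltnS => le_mn.
by have := IH _ le_mn; lia.
Qed.

Definition cantor (u v : nat) : nat := tri (u + v) + v.

(** Cell [a] receives the sum [u + v]; counting it down to 0 while adding it to cell [b] yields the
    triangular number of [u + v] plus [v]. *)
Definition pack (a b : nat) : com instr :=
  block [:: Op (IAdd a a b);
            While a (block [:: Op (IAdd b b a); Op (ISub a a 0)])].

(** Subtracts 1, 2, 3, ... from the code, with the diagonal in cell 2, as long as the rest exceeds
    the diagonal. This stops on diagonal [u + v] with rest [v], and both components go to array
    1. *)
Definition unpack (b : nat) : com instr :=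
  block [:: Op (IConst 2 0); Op (ISub 6 b 2);
            While 6 (block [:: Op (IAdd 2 2 0); Op (ISub b b 2); Op (ISub 6 b 2)]);
            Op (ISub 2 2 b);
            Op (IConst 6 b.-1); Op (IAdd 6 6 4); Op (IStore 6 2);
            Op (IAdd 6 6 0); Op (IStore 6 b)].

Lemma pack_spec a m : a \in [:: 2; 4; 6] -> m 0 = 1 ->
  wp (l := ram) (pack a a.+1) m (fun m1 t =>
    [/\ m1 a.+1 = cantor (m a) (m a.+1),
        forall x, x != a -> x != a.+1 -> m1 x = m x
      & t <= 4 * (m a + m a.+1) + 2]).
Proof.
move=> ha m0; apply: vc_wp; rewrite /pack; split=> //.
pose I f (s : nat -> nat) :=
  [/\ f = 4 * s a, s 0 = 1, s a.+1 + tri (s a) = cantor (m a) (m a.+1)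
    & forall x, x != a -> x != a.+1 -> s x = m x].
apply: (@wp_while ram I _ _ _ (4 * (m a + m a.+1))).
- move=> f s [-> s0 sb sx] nz /=.
  have {}nz : s a != 0 by [].
  do 2!split=> //; exists (4 * (s a - 1)); last by lia.
  move: ha; rewrite !inE => /or3P [] /eqP ea; subst a; rewrite /I /upd /= s0;
   (split=> // [|x /negbTE xa /negbTE xb]; last by rewrite xa xb sx ?xa ?xb);
   rewrite -sb; case: (s _) nz => // k _; rewrite subn1 /=; lia.
- move: ha; rewrite !inE => /or3P [] /eqP ea; subst a; rewrite /I /= /upd /=;
   by split=> // [|x /negbTE -> //]; rewrite /cantor addnC.
- move=> f s t [_ _ sb sx] /= sa le_t; split=> //; last by lia.
  by rewrite -sb sa addn0.
Qed.

Lemma unpack_spec b B u v m : b \in [:: 3; 5; 7] -> 32 <= B ->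
  m 0 = 1 -> m 4 = B -> m b = cantor u v ->
  wp (l := ram) (unpack b) m (fun m1 t =>
    [/\ m1 (B + b.-1) = u, m1 (B + b) = v,
        forall x, x \notin [:: 2; 6; b; B + b.-1; B + b] -> m1 x = m x
      & t <= 5 * (u + v) + 10]).
Proof.
move=> hb B32 m0 m4 mb; apply: vc_wp; rewrite /unpack; do 2!split=> //.
pose I f (s : nat -> nat) :=
  [/\ f = 5 * (u + v - s 2), s 2 <= u + v, s b + tri (s 2) = cantor u v,
     s 6 = s b - s 2
    & forall x, x \notin [:: 2; 6; b] -> s x = m x].
apply: (@wp_while ram I _ _ _ (5 * (u + v))).
- move=> f s [-> le2 sb s6 sx] nz /=.
  have {}nz : s 6 != 0 by [].
  have s0 : s 0 = 1.
    by rewrite sx //; move: hb; rewrite !inE => /or3P [] /eqP ->.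
  (* On diagonal [u + v] the rest is [v], which does not exceed the diagonal, so the guard would be
     0. *)
  have lt2 : s 2 < u + v.
    rewrite ltn_neqAle le2 andbT; apply/eqP => e2.
    by move: sb s6 nz; rewrite e2 /cantor; lia.
  do 3!split=> //; exists (5 * (u + v - (s 2).+1)); last by lia.
  move: hb; rewrite !inE => /or3P [] /eqP ea; subst b; rewrite /I /= /upd /= s0 addn1;
   (split=> // [|x]; [by move: sb s6 nz => /=; lia
     | by rewrite !inE => /norP [xa /norP [xb xc]];
       rewrite (negbTE xa) (negbTE xb) (negbTE xc) sx // !inE !negb_or xa xb]).
- move: hb; rewrite !inE => /or3P [] /eqP ea; subst b; rewrite /I /= /upd /= mb;
   (split; rewrite ?subn0 ?addn0 // => x;
    rewrite !inE => /norP [xa /norP [xb xc]];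
    by rewrite (negbTE xa) (negbTE xb)).
move=> f s t [_ le2 sb s6 sx] /= z le_t.
(* On an earlier diagonal the rest still exceeds the diagonal, so the guard could not be 0. *)
have e2 : s 2 = u + v.
  apply/eqP; rewrite eqn_leq le2 leqNgt; apply/negP => lt2.
  by have := tri_le lt2; move: sb; rewrite z in s6; rewrite /cantor /=; lia.
have {}sb : s b = v by move: sb; rewrite e2 /cantor; lia.
have s4 : s 4 = B by rewrite sx //; move: hb; rewrite !inE => /or3P [] /eqP ->.
have s0 : s 0 = 1 by rewrite sx //; move: hb; rewrite !inE => /or3P [] /eqP ->.
do 6!split=> //.
have no c d : c < 8 -> (c == d + B) = false by lia.
move: hb; rewrite !inE => /or3P [] /eqP ea; subst b;
rewrite /upd /= s4 (no 6) // ?(no 3) ?(no 5) ?(no 7) // s0 e2 sb addnK;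
(split; [by do ?[case: eqP => //]; lia | by do ?[case: eqP => //]; lia | | by lia]);
move=> x; rewrite !inE => /norP [x1 /norP [x2 /norP [x3 /norP [x4 x5]]]];
do ?[case: eqP => ?]; try lia;
by rewrite sx // !inE !negb_or x1 x2.
Qed.

(** Cell 2 starts at four times the number of rules plus 8, a budget of zeros that the input cannot
    exhaust. The pointer in cell 4 starts above the cells altered by the pairing. *)
Definition scan : com instr :=
  block [:: Op (IConst 2 2); Op (IAdd 2 2 1); Op (IAdd 2 2 2); Op (IAdd 2 2 2);
            Op (IConst 4 8);
            While 2 (block [:: Op (ILoad 6 4); Op (IAdd 4 4 0);
                               If 6 Skip (Op (ISub 2 2 0))])].

Lemma count_nth0_iota (w : seq nat) a b : a + b <= size w ->
  count (fun j => nth 0 w j == 0) (iota a b) <= count (pred1 0) w.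
Proof.
move=> le_ab; rewrite -{2}(mkseq_nth 0 w) /mkseq count_map.
have -> : size w = a + b + (size w - (a + b)) by lia.
rewrite !iotaD !count_cat add0n.
by rewrite -addnA addnCA leq_addr.
Qed.

(* Seeing more zeros than the input contains means having left the input. *)
Lemma scan_spec (w : seq nat) m :
  count (pred1 0) w <= 3 * m 1 + 4 -> m 0 = 1 ->
  (forall j, 8 <= j -> m j = nth 0 w j) ->
  wp (l := ram) scan m (fun m1 t =>
    [/\ size w < m1 4,
        m1 4 <= size w + 4 * m 1 + 16,
        forall x, x \notin [:: 2; 4; 6] -> m1 x = m x
      & t <= 6 * (size w + 4 * m 1 + 8) + 6]).
Proof.
move=> hz m0 hw; apply: vc_wp; rewrite /scan; do 5!split=> //.
pose z p := count (fun j => nth 0 w j == 0) (iota 8 (p - 8)).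
(* With truncated subtraction, [s 4 + (size w - s 4)] is the maximum of pointer and input length:
   beyond the input every step uses up one unit of the budget. *)
pose I f (s : nat -> nat) :=
  [/\ f = 6 * (size w - s 4 + s 2), 8 <= s 4,
      s 4 + (size w - s 4) + s 2 <= size w + 4 * m 1 + 16,
      s 2 + z (s 4) = 4 * m 1 + 8
    & forall x, x \notin [:: 2; 4; 6] -> s x = m x].
have zS p : 8 <= p -> z p.+1 = z p + (nth 0 w p == 0).
  by move=> p8; rewrite /z subSn // -(addn1 (p - 8)) iotaD count_cat /= addn0 subnKC.

apply: (@wp_while ram I _ _ _ (6 * (size w - 8 + (4 * m 1 + 8)))).
- move=> f s [-> p8 le_p cz sx] nz.
  have {}nz : s 2 != 0 by [].
  have sw : s (s 4) = nth 0 w (s 4) by rewrite sx ?hw // !inE; lia.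
  have s0 : s 0 = 1 by rewrite sx.
  have {}zS := zS _ p8.
  do 2!split=> //; rewrite /= /upd /= s0 addn1 sw.
  have lt_p : nth 0 w (s 4) != 0 -> s 4 < size w.
    by apply: contraR; rewrite -leqNgt => le_w; rewrite nth_default.
  case: eqP => [w0|/eqP w0].
    split=> //; exists (6 * (size w - (s 4).+1 + (s 2 - 1))); last by lia.
    rewrite w0 /= in zS; rewrite /I /= zS.
    split=> //; [by lia | by lia | by lia |] => x.
    rewrite !inE => /norP [x1 /norP [x2 x3]].
    by rewrite (negbTE x1) (negbTE x2) (negbTE x3) sx // !inE !negb_or x1 x2.
  have {}lt_p := lt_p w0; rewrite (negbTE w0) /= in zS.
  exists (6 * (size w - (s 4).+1 + s 2)); last by lia.
  rewrite /I /= zS.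
  split=> //; [by lia | by lia | by lia |] => x.
  rewrite !inE => /norP [x1 /norP [x2 x3]].
  by rewrite (negbTE x2) (negbTE x3) sx // !inE !negb_or x1 x2.
- rewrite /I /= /upd /= /z subnn /=.
  split=> //; [by lia | by lia | by lia |] => x.
  rewrite !inE => /norP [x1 /norP [x2 x3]].
  by rewrite (negbTE x1) (negbTE x2).
move=> f s t [_ p8 le_p cz sx] /= s2 le_t; split=> //; [| by lia | by lia].
(* A pointer still inside the input would have passed more zeros than the input contains. *)
rewrite ltnNge; apply/negP => le_w.
have := @count_nth0_iota w 8 (s 4 - 8); rewrite subnKC // => /(_ le_w).
by move: cz; rewrite /z s2; lia.
Qed.

(** Adding 32 to the pointer leaves room for the registers below the stride. Offsets run downwards
    from [B - 1] and stop at 0; cell 2 is in turn guard, source address and copied value. *)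
Definition copy : com instr :=
  block [:: Op (IConst 6 32); Op (IAdd 4 4 6);
            Op (IAdd 6 4 4); Op (ISub 6 6 0); Op (ISub 2 6 4);
            While 2 (block [:: Op (ILoad 2 2); Op (IStore 6 2);
                               Op (ISub 6 6 0); Op (ISub 2 6 4)])].

Lemma copy_spec p m : m 0 = 1 -> m 4 = p ->
  wp (l := ram) copy m (fun m1 t =>
    let B := p + 32 in
    [/\ m1 4 = B,
        forall j, j \notin [:: 2; 4; 6] -> 0 < j < B -> m1 (B + j) = m j,
        forall j, j \notin [:: 2; 4; 6] -> j < B -> m1 j = m j,
        forall x, 2 * B <= x -> m1 x = m x
      & t <= 6 * B + 6]).
Proof.
move=> m0 m4; apply: vc_wp; rewrite /copy; do 5!split=> //.
have : 32 <= p + 32 by lia.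
move eB : (p + 32) => B B32.
pose I f (s : nat -> nat) :=
  [/\ f = 6 * s 2, s 4 = B, s 2 < B /\ s 6 = B + s 2,
      forall j, j \notin [:: 2; 4; 6] -> s 2 < j < B -> s (B + j) = m j
    & forall j, j \notin [:: 2; 4; 6] -> j < B \/ 2 * B <= j -> s j = m j].
apply: (@wp_while ram I _ _ _ (6 * (B - 1))).
- move=> f s [-> s4 [s2 s6] sc sx] nz.
  have {}nz : s 2 != 0 by [].
  do 4!split=> //; exists (6 * (s 2 - 1)); last by lia.
  have s0 : s 0 = 1 by rewrite sx //; left ; lia.
  rewrite /I /= /upd /= s6 s4.
  have [B0 B1 B2 B3] : [/\ (4 == B + s 2) = false, (6 == B + s 2) = false,
   (0 == B + s 2) = false & (2 == B + s 2) = false] by split; lia.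
  rewrite B0 B1 B2 s0 ?s4 ?s6.
  have eD : B + s 2 - 1 - B = s 2 - 1 by lia.
  rewrite eD; split=> //; [by lia | move=> j j1 j2 | move=> j j1 j2].
    do 2!(rewrite ifF; last by lia); rewrite eqn_add2l.
    case: eqP => [ej|nj]; last by rewrite ifF ?sc //; lia.
    by rewrite -ej sx //; left; lia.
  move: (j1); rewrite !inE => /norP [/negbTE x1 /norP [_ /negbTE x3]].
  rewrite x1 x3 ifF; last by case: j2; lia.
  by rewrite sx.
- rewrite /I /= /upd /= m4 m0 eB.
  split=> //; [by lia | by lia | by move=> j _; lia |] => j.
  rewrite !inE => /norP [/negbTE x1 /norP [/negbTE x2 /negbTE x3]].
  by rewrite x1 x2 x3.
move=> f s t [_ s4 [s2 s6] sc sx] /= z le_t; split=> //; last by lia.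
- by move=> j j1 j2; apply: sc; rewrite ?z.
- by move=> j j1 j2; apply: sx => //; left.
- by move=> x hx; apply: sx; [rewrite !inE; lia | right].
Qed.

(* Cells 2, 4 and 6 are vacated by pairing their contents with those of cells 3,
   5 and 7. *)
Definition prelude : com instr :=
  block [:: Op (IConst 0 1); pack 2 3; pack 4 5; pack 6 7; scan; copy;
            unpack 3; unpack 5; unpack 7].

(** The bound [V] on the entries controls the unary loops. Addresses from [2 * B] on lie beyond the
    input and are never written, so the other arrays start out zero. *)
Lemma prelude_spec (w : seq nat) V :
  (forall j, nth 0 w j <= V) -> count (pred1 0) w <= 3 * nth 0 w 1 + 4 ->
  wp (l := ram) prelude (nth 0 w) (fun m t => exists B,
    [/\ 32 <= B /\ size w < B, m 0 = 1 /\ m 4 = B,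
        forall j, 0 < j < B -> m (B + j) = nth 0 w j,
        forall x, 2 * B <= x -> m x = 0
      & t <= 102 * V + 12 * size w + 400]).
Proof.
move=> hV hz; rewrite /prelude /block /=.
apply: wp_seq; exists (upd (nth 0 w) 0 1), 1; split; first exact: (@ev_op ram).
set m0 := upd _ _ _.
have m0E x : x != 0 -> m0 x = nth 0 w x by rewrite /m0 /upd => /negbTE ->.
apply: wp_seq; apply: wp_mono (@pack_spec 2 m0 isT erefl) => m1 u1 [m1b m1x le1].
have m10 : m1 0 = 1 by rewrite m1x.
apply: wp_seq; apply: wp_mono (@pack_spec 4 m1 isT m10) => m2 u2 [m2b m2x le2].
have m20 : m2 0 = 1 by rewrite m2x.
apply: wp_seq; apply: wp_mono (@pack_spec 6 m2 isT m20) => m3 u3 [m3b m3x le3].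
have m30 : m3 0 = 1 by rewrite m3x.
rewrite !m0E // in m1b le1.
rewrite !m1x // !m0E // in m2b le2.
rewrite !m2x // !m1x // !m0E // in m3b le3.
have m31 : m3 1 = nth 0 w 1 by rewrite m3x // m2x // m1x // m0E.
have m3w j : 8 <= j -> m3 j = nth 0 w j.
  by move=> j8; rewrite m3x ?m2x ?m1x ?m0E //; lia.
rewrite -m31 in hz.
apply: wp_seq; apply: wp_mono (scan_spec hz m30 m3w) => m4 u4 [ltB leB m4x le4].
have m40 : m4 0 = 1 by rewrite m4x.
apply: wp_seq; apply: wp_mono (copy_spec m40 erefl) => m5 u5.
move eB : (m4 4 + 32) => B [m54 m5B m5l m5h le5].
have [B32 BL] : 32 <= B /\ size w < B by lia.
have le31 : m3 1 <= V by rewrite m31.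
have m50 : m5 0 = 1 by rewrite m5l //; lia.
have p3 : m5 3 = cantor (nth 0 w 2) (nth 0 w 3).
  by rewrite m5l ?m4x ?m3x ?m2x ?m1b //; lia.
have p5 : m5 5 = cantor (nth 0 w 4) (nth 0 w 5).
  by rewrite m5l ?m4x ?m3x ?m2b //; lia.
have p7 : m5 7 = cantor (nth 0 w 6) (nth 0 w 7) by rewrite m5l ?m4x ?m3b //; lia.
apply: wp_seq; apply: wp_mono (@unpack_spec 3 B _ _ m5 isT B32 m50 m54 p3).
move=> m6 u6 [m6a m6b m6x le6].
have small y : y < 8 -> y \notin [:: 2; 6; 3] -> m6 y = m5 y.
  by move=> y8; rewrite !inE => hy; apply: m6x; rewrite !inE; lia.
have m60 : m6 0 = 1 by rewrite small.
have m64 : m6 4 = B by rewrite small.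
have {}p5 : m6 5 = cantor (nth 0 w 4) (nth 0 w 5) by rewrite small.
have {}p7 : m6 7 = cantor (nth 0 w 6) (nth 0 w 7) by rewrite small.
apply: wp_seq; apply: wp_mono (@unpack_spec 5 B _ _ m6 isT B32 m60 m64 p5).
move=> m7 u7 [m7a m7b m7x le7].
have {}small y : y < 8 -> y \notin [:: 2; 6; 5] -> m7 y = m6 y.
  by move=> y8; rewrite !inE => hy; apply: m7x; rewrite !inE; lia.
have m70 : m7 0 = 1 by rewrite small.
have m74 : m7 4 = B by rewrite small.
have {}p7 : m7 7 = cantor (nth 0 w 6) (nth 0 w 7) by rewrite small.
apply: wp_last; apply: wp_mono (@unpack_spec 7 B _ _ m7 isT B32 m70 m74 p7).
move=> m8 u8 [m8a m8b m8x le8].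
have {}small y : y < 8 -> y \notin [:: 2; 6; 7] -> m8 y = m7 y.
  by move=> y8; rewrite !inE => hy; apply: m8x; rewrite !inE; lia.
exists B; split=> //; first by rewrite !small.
- move=> j; have [j8 hj|] := leqP 8 j.
    rewrite m8x ?m7x ?m6x ?m5B ?m4x ?m3w // !inE; lia.
  case: j => [|[|[|[|[|[|[|[|j]]]]]]]] // _ _.
  + by rewrite m8x ?m7x ?m6x ?m5B ?m4x // ?inE; lia.
  + by rewrite m8x ?m7x // !inE /=; lia.
  + by rewrite m8x ?m7x // !inE /=; lia.
  + by rewrite m8x // !inE /=; lia.
  + by rewrite m8x // !inE /=; lia.
- move=> x hx; rewrite m8x ?m7x ?m6x ?m5h ?m4x ?m3w; try by rewrite ?inE /=; lia.
  by rewrite nth_default //; lia.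
(* The factor 102 is 24 for the packings, 24 for the scan, 24 for the copy and 30 for the
   unpackings. *)
have := (hV 2); have := hV 3; have := hV 4; have := hV 5; have := hV 6.
by have := hV 7; lia.
Qed.

(** * Reading the rules *)

Lemma vc_op l (o : op l) k s (Q : st l -> nat -> Prop) :
  pre o s -> vc k (eff o s) (fun s1 t => Q s1 t.+1) -> vc (Seq (Op o) k) s Q.
Proof. by []. Qed.

Lemma vc_if l a (c d k : com (op l)) s (Q : st l -> nat -> Prop) :
  (rd s a = 0 ->
     vc d s (fun s1 t => vc k s1 (fun s2 t2 => Q s2 (t.+1 + t2)))) ->
  (rd s a <> 0 ->
     vc c s (fun s1 t => vc k s1 (fun s2 t2 => Q s2 (t.+2 + t2)))) ->
  vc (Seq (If a c d) k) s Q.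
Proof. by move=> h1 h2 /=; case: eqP. Qed.

Lemma vc_seq l (c d : com (op l)) s (Q : st l -> nat -> Prop) :
  vc c s (fun s1 t1 => vc d s1 (fun s2 t2 => Q s2 (t1 + t2))) -> vc (Seq c d) s Q.
Proof. by []. Qed.

Lemma vc_skip l s (Q : st l -> nat -> Prop) : Q s 0 -> vc (l := l) Skip s Q.
Proof. by []. Qed.

Lemma vc_while l (I : nat -> st l -> Prop) a (c k : com (op l)) Q phi s :
  (forall f s, I f s -> rd s a <> 0 ->
     vc c s (fun s1 t => exists2 f1, I f1 s1 & t + 2 + f1 <= f)) ->
  I phi s ->
  (forall f s1 t, I f s1 -> rd s1 a = 0 -> t <= phi.+1 ->
     vc k s1 (fun s2 t2 => Q s2 (t + t2))) ->
  vc (Seq (While a c) k) s Q.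
Proof.
move=> hc hI hk; apply: (wp_while _ hI hk) => f s1 I1 /eqP nz.
exact: hc I1 nz.
Qed.

Lemma vc_mono l (c : com (op l)) s (Q Q1 : st l -> nat -> Prop) :
  vc c s Q -> (forall s t, Q s t -> Q1 s t) -> vc c s Q1.
Proof.
elim: c s Q Q1 => [|o|c IHc d IHd|a c IHc d IHd|a c IHc] s Q Q1; rewrite /vc -/vc.
- by move=> HQ /(_ _ _ HQ).
- by case=> ho HQ /(_ _ _ HQ).
- move=> h sub; apply: IHc h _ => s1 t1 h; apply: IHd h _ => s2 t2; exact: sub.
- by case: ifP => _ h sub; [apply: IHd h _ | apply: IHc h _] => s1 t; apply: sub.
- by move=> h sub; apply: wp_mono h.
Qed.

(* Unfolded at once, the condition of a long block grows exponentially: it is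
   computed one operation at a time, normalizing the state after each. *)
Arguments vc : simpl never.

Ltac step :=
  apply: vc_op; [first [by [] | by split=> //=; lia] | rewrite /= /upd /=].

(* Body and head of a rule. *)
Definition lrule : Type := (seq nat * nat)%type.

Definition rule0 : lrule := ([::], 0).

Definition lrule_enc (r : lrule) : seq nat := size r.1 :: r.2 :: r.1.

(** Reversed, since new cells are put at the front of a linked list. *)
Definition occ (L : seq lrule) (a : nat) : seq nat :=
  rev [seq i <- iota 0 (size L) | a \in (nth rule0 L i).1].

Lemma occ_rcons L r a :
  occ (rcons L r) a = if a \in r.1 then size L :: occ L a else occ L a.
Proof.
rewrite /occ size_rcons -addn1 iotaD filter_cat rev_cat /= nth_rcons ltnn eqxx.
have -> : [seq i <- iota 0 (size L) | a \in (nth rule0 (rcons L r) i).1] =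
          [seq i <- iota 0 (size L) | a \in (nth rule0 L i).1].
  by apply: eq_in_filter => i; rewrite mem_iota /= => lt_i; rewrite nth_rcons lt_i.
by case: (a \in r.1).
Qed.

(** A linked list with first cell [h], successors [N] and contents [O]. Cells are numbered from 1 to
    [e], so that 0 can mean the end. *)
Fixpoint chain (e : nat) (N O : nat -> nat) (h : nat) (s : seq nat) : Prop :=
  if s is i :: s1 then [/\ 0 < h <= e, O h = i & chain e N O (N h) s1]
  else h = 0.

(** Used when a fresh cell beyond [e] is allocated: existing lists survive. *)
Lemma eq_chain e e1 N N1 O O1 h s :
  chain e N O h s -> e <= e1 -> (forall x, x <= e -> N1 x = N x) ->
  (forall x, x <= e -> O1 x = O x) -> chain e1 N1 O1 h s.
Proof.
move=> + le_e eN eO; elim: s h => //= i s IH h [/andP [h0 le_h] <- /IH c].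
by rewrite eN // eO // h0 (leq_trans le_h).
Qed.

(* The arrays used by the algorithm: 1 holds the input; 2 the number of
   unsatisfied rules with a given head; 3 the first cell of the linked list of
   occurrences of a given element, 4 the successor of a cell and 5 its rule;
   6 the flags of satisfied rules; 7 their heads; 8 the characteristic function
   of X; 9 the queue of added elements. *)
Definition tables (B : nat) (L : seq lrule) (e : nat) (A : nat -> nat -> nat) :=
  [/\ forall x, x < B ->
        A 2 x = count (fun r : lrule => (r.2 == x) && (r.2 \notin r.1)) L,
      forall i, i < B -> A 6 i = ((nth rule0 L i).2 \in (nth rule0 L i).1),
      forall i, i < B -> A 7 i = (nth rule0 L i).2
    & forall a, a < B -> chain e (A 4) (A 5) (A 3 a) (occ L a)].

(** A rule is entered with empty body, hence as unsatisfied, before its elements are read. *)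
Lemma tables_new_rule B L e A q : tables B L e A -> size L < B ->
  tables B (rcons L ([::], q)) e
    (updA (updA A 7 (size L) q) 2 q (A 2 q + 1)).
Proof.
move=> [h2 h6 h7 hc] ltL; rewrite /tables /updA /=; split=> [x|i|i|a] ltB.
- rewrite -cats1 count_cat /= andbT addn0 /upd eq_sym.
  by case: eqP => [->|_]; rewrite ?addn0 h2.
- rewrite nth_rcons h6 //; case: ltngtP => // [lt_i|->].
  by rewrite nth_default // ltnW.
  by rewrite nth_default.
- rewrite /upd nth_rcons; case: ltngtP => // [_|lt_i]; first exact: h7.
  by rewrite h7 // nth_default // ltnW.
- by rewrite occ_rcons; apply: hc.
Qed.

Definition add_elem (A : nat -> nat -> nat) (e i a q : nat) :=
  let A1 := updA (updA (updA A 4 e.+1 (A 3 a)) 3 a e.+1) 5 e.+1 i in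
  if a == q then updA (updA A1 6 i 1) 2 q (A 2 q - 1) else A1.

(** As [a] is new in the body, it gets one list cell for this rule, and the counter of [q] drops at
    most once, namely when the head itself turns up. *)
Lemma tables_add_elem B L e A l a q :
  tables B (rcons L (l, q)) e A -> a \notin l -> a < B -> q < B -> size L < B ->
  tables B (rcons L (rcons l a, q)) e.+1 (add_elem A e (size L) a q).
Proof.
move=> [h2 h6 h7 hc] a_l aB qB LB.
have chain_a y : y < B -> chain e.+1 (upd (A 4) e.+1 (A 3 a))
    (upd (A 5) e.+1 (size L)) (upd (A 3) a e.+1 y)
    (occ (rcons L (rcons l a, q)) y).
  move=> yB; rewrite occ_rcons /= mem_rcons inE {3}/upd.
  have c := hc _ yB; rewrite occ_rcons /= in c.
  case: (eqVneq y a) c => [-> | ya] /= c.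
    rewrite (negbTE a_l) in c; rewrite ltnS leqnn /upd eqxx; split=> //.
    by apply: eq_chain c _ _ _ => // x le_x; rewrite ifF //; lia.
  by apply: eq_chain c _ _ _ => // x le_x; rewrite /upd ifF //; lia.
have heads i : (nth rule0 (rcons L (rcons l a, q)) i).2 =
               (nth rule0 (rcons L (l, q)) i).2.
  by rewrite !nth_rcons; case: ltngtP.
rewrite /add_elem; case: eqP => [eaq | naq].
  rewrite /tables /updA /=; split=> // [x|i|i] ltB.
  - have qL : q \notin l by rewrite -eaq.
    have := h2 _ qB; have := h2 _ ltB; rewrite -!cats1 !count_cat /=.
    rewrite mem_cat inE eaq eqxx orbT andbF !addn0 qL /= /upd eq_sym => -> ->.
    by case: eqP => [->|_] /=; lia.
  - rewrite /upd; have := h6 _ ltB; rewrite !nth_rcons.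
    case: ltngtP => [lt_i|lt_i|e_i] //= _.
    by rewrite mem_rcons inE eaq eqxx.
  - by rewrite heads; apply: h7.
rewrite /tables /updA /=; split=> // [x|i|i] ltB.
- rewrite h2 // -!cats1 !count_cat /= mem_cat inE negb_or.
  by have /negbTE -> : q != a; [apply/eqP => e1; apply: naq | rewrite andbT].
- have := h6 _ ltB; rewrite !nth_rcons; case: ltngtP => //= _ ->.
  by rewrite mem_rcons inE; case: eqP => // e1; case: naq.
- by rewrite heads; apply: h7.
Qed.

Definition input_at (B : nat) (W : nat -> nat) (p : nat) (l : seq nat) : Prop :=
  p + size l <= B /\ forall j, j < size l -> W (p + j) = nth 0 l j.

Lemma input_at_cons B W p x l : input_at B W p (x :: l) ->
  [/\ p < B, W p = x & input_at B W p.+1 l].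
Proof.
case=> /= le_B h; split; first by lia.
  by have := h 0 isT; rewrite addn0.
by split=> [|j lt_j]; [lia | rewrite addSnnS h].
Qed.

(* Registers: 0 holds 1; 1 and 12 are the ends of the queue; 2 counts the list
   cells; 3 is the current rule; 6 counts the rules still to be read; 7 points
   into the input; 8 counts the elements still to be read; 9 and 10 hold a head
   and an element; 13 is the current list cell; 14 is the guard of the main
   loop; 15 is the size of X; 11 and 16 are temporary. *)
Definition parse_elem : com aop :=
  block [:: Op (ALoad 10 1 7); Op (AAdd 7 7 0); Op (AAdd 2 2 0);
            Op (ALoad 11 3 10); Op (AStore 4 2 11); Op (AStore 3 10 2);
            Op (AStore 5 2 3);
            Op (ASub 11 10 9); Op (ASub 16 9 10); Op (AAdd 11 11 16);
            If 11 Skip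
              (block [:: Op (AStore 6 3 0); Op (ALoad 11 2 9);
                         Op (ASub 11 11 0); Op (AStore 2 9 11)]);
            Op (ASub 8 8 0)].

Definition parse_rule : com aop :=
  block [:: Op (ALoad 8 1 7); Op (AAdd 7 7 0); Op (ALoad 9 1 7); Op (AAdd 7 7 0);
            Op (AStore 7 3 9); Op (ALoad 11 2 9); Op (AAdd 11 11 0);
            Op (AStore 2 9 11);
            While 8 parse_elem;
            Op (AAdd 3 3 0); Op (ASub 6 6 0)].

Definition parse : com aop :=
  block [:: Op (AConst 2 0); Op (AConst 3 0); Op (AConst 7 1); Op (ALoad 6 1 7);
            Op (AConst 7 2); While 6 parse_rule].

(** List cells and rules are charged to input cells already read: the bound by the input pointer
    keeps all array indices below [B]. *)
Lemma parse_elem_spec B L W M l a l2 q s :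
  tables B (rcons L (l, q)) (s.1 2) s.2 -> s.2 1 = W -> s.2 8 = M ->
  s.1 0 = 1 -> s.1 3 = size L -> s.1 9 = q -> s.1 2 + s.1 3 < s.1 7 ->
  input_at B W (s.1 7) (a :: l2) -> a \notin l -> a < B -> q < B ->
  vc (l := arrm B) parse_elem s (fun s1 t =>
    [/\ tables B (rcons L (rcons l a, q)) (s1.1 2) s1.2,
        s1.2 1 = W /\ s1.2 8 = M,
        [/\ s1.1 0 = 1, s1.1 3 = s.1 3, s1.1 6 = s.1 6, s1.1 9 = q
          & s1.1 8 = s.1 8 - 1],
        [/\ s1.1 2 = (s.1 2).+1, s1.1 7 = (s.1 7).+1
          & input_at B W (s1.1 7) l2]
      & t <= 20]).
Proof.
case: s => r A /=; move=> tab eW eM r0 r3 r9 lt_p /input_at_cons [pB Wp inp] a_l aB qB.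
have LB : size L < B by lia.
have tab1 := tables_add_elem tab a_l aB qB LB.
rewrite /parse_elem; step; rewrite eW Wp; step; rewrite r0 addn1; step.
rewrite r0 addn1; do 4!step; rewrite r3; do 3!step; rewrite r9.
(* Equality is tested by adding the two truncated differences. *)
have eqE : (a - q + (q - a) == 0) = (a == q) by lia.
apply: vc_if => /= [/eqP|/eqP]; rewrite eqE => eaq.
  do 4!step; apply: vc_skip => /=; step; apply: vc_skip => /=.
  rewrite r0 r3 r9; rewrite /add_elem eaq in tab1.
  by split.
apply: vc_skip => /=; step; apply: vc_skip => /=.
rewrite r0 r3 r9; rewrite /add_elem (negbTE eaq) in tab1.
by split.
Qed.

Definition rules_ok (B : nat) (L : seq lrule) : bool :=
  all (fun r : lrule => [&& uniq r.1, r.2 < B & all (fun a => a < B) r.1]) L.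

Definition rules_enc (L : seq lrule) : seq nat := flatten (map lrule_enc L).

Definition parsed B (W M : nat -> nat) L L1 rest (s : ast) : Prop :=
  [/\ tables B L1 (s.1 2) s.2, s.2 1 = W /\ s.2 8 = M,
      [/\ s.1 0 = 1, s.1 3 = size L1 & s.1 2 + s.1 3 < s.1 7],
      s.1 6 = size L
    & input_at B W (s.1 7) (rules_enc L ++ rest)].

Definition parse_time (L : seq lrule) : nat :=
  \sum_(r <- L) (22 * size r.1 + 20).

Lemma parse_rule_spec B W M r L L1 rest s :
  rules_ok B [:: r] -> parsed B W M (r :: L) L1 rest s ->
  vc (l := arrm B) parse_rule s (fun s1 t =>
    parsed B W M L (rcons L1 r) rest s1 /\ t <= 22 * size r.1 + 18).
Proof.
case: s r => R A [l q]; rewrite /= andbT => /and3P /= [ul qB lB].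
case=> /= tab [eW eM] [r0 r3 lt_p] r6.
rewrite /rules_enc /= => /input_at_cons [pB Wp /input_at_cons [pB1 Wp1 inp]].
have LB : size L1 < B by lia.
rewrite /parse_rule; step; rewrite eW Wp; step; rewrite r0 addn1; step.
rewrite eW Wp1; step; rewrite r0 addn1; do 2!step; rewrite r3; step; rewrite r0; step.
(* The body splits into a part read and a part to be read. The successor in the pointer bound
   reserves the later increment of the rule counter. *)
pose I f (s : ast) := exists l1 l2, [/\ l1 ++ l2 = l, f = 22 * size l2,
  tables B (rcons L1 (l1, q)) (s.1 2) s.2 /\ (s.2 1 = W /\ s.2 8 = M),
  [/\ s.1 0 = 1, s.1 3 = size L1, s.1 6 = R 6, s.1 9 = q & s.1 8 = size l2]
  & (s.1 2 + s.1 3).+1 < s.1 7 /\ input_at B W (s.1 7) (l2 ++ rules_enc L ++ rest)].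
apply: (@vc_while (arrm B) I _ _ _ _ (22 * size l)).
- move=> f s [l1 [[|a l2] [el -> [tb [sW sM]] [s0 s3 s6 s9 s8] [lt_s inps]]]] nz.
    by case: nz.
  rewrite -el cat_uniq /= negb_or in ul; rewrite -el all_cat /= in lB.
  case/and3P: lB => _ aB _; case/and3P: ul => _ /andP [a_l1 _] _.
  apply: vc_mono (parse_elem_spec tb sW sM s0 s3 s9 (ltnW lt_s) inps a_l1 aB qB) _.
  move=> s1 t [tb1 [sW1 sM1] [s10 s13 s16 s19 s18] [s12 s17 inp1] le_t].
  exists (22 * size l2); last by rewrite /=; lia.
  exists (rcons l1 a), l2; split=> //; first by rewrite cat_rcons.
  - by rewrite s13 s16 s18 s8 /= subn1.
  - by split=> //; rewrite s12 s17 s13.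
- exists [::], l; rewrite /I /=; split=> //.
  + have -> : updA A 7 (size L1) q 2 q = A 2 q by [].
    by split; first exact: (tables_new_rule q tab LB).
  + by split; [lia | rewrite catA].
move=> f s t [l1 [[|x l2] [el _ [tb [sW sM]] [s0 s3 s6 s9 s8] [lt_s inps]]]] /=;
  last by rewrite s8.
move=> _ le_t.
rewrite cats0 in el; rewrite el in tb.
step; step; apply: vc_skip => /=; split; last by lia.
split=> //=; rewrite ?size_rcons s0 ?s3 ?s6 ?r6 ?subn1 ?addn1 //.
by split=> //; lia.
Qed.

Lemma parse_spec B W M n L rest s :
  s.2 1 = W -> s.2 8 = M -> s.1 0 = 1 ->
  (forall k j, 2 <= k <= 7 -> j < B -> s.2 k j = 0) ->
  rules_ok B L -> W 1 = size L -> 2 + size (rules_enc L ++ rest) <= B ->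
  (forall j, 0 < j < B -> W j = nth 0 (n :: size L :: rules_enc L ++ rest) j) ->
  vc (l := arrm B) parse s (fun s1 t =>
    parsed B W M [::] L rest s1 /\ t <= parse_time L + 6).
Proof.
case: s => R A /= eW eM r0 A0 okL W1 le_B hW.
rewrite /parse; step; step; step; step; rewrite eW W1; step.
pose I f (s : ast) := exists L1 L2, [/\ L1 ++ L2 = L, f = parse_time L2
  & parsed B W M L2 L1 rest s].
apply: (@vc_while (arrm B) I _ _ _ _ (parse_time L)).
- move=> f s [L1 [[|r L2] [eL -> ps]]] nz; first by case: ps nz => _ _ _ /= ->.
  have ok1 : rules_ok B [:: r].
    by move: okL; rewrite -eL /rules_ok all_cat /= => /and3P [_ -> _].
  apply: vc_mono (parse_rule_spec ok1 ps) _ => s1 t [ps1 le_t].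
  exists (parse_time L2); last by rewrite /parse_time big_cons; lia.
  by exists (rcons L1 r), L2; split=> //; rewrite cat_rcons.
- exists [::], L; split=> //; split=> //=.
    split=> [x|i|i|a] ltB; rewrite ?nth_nil ?A0 //.
  split=> // j lt_j; rewrite hW //; lia.
move=> f s t [L1 [[|r L2] [eL _ ps]]] /= z le_t; last by case: ps z => _ _ _ ->.
by apply: vc_skip; rewrite cats0 in eL; rewrite -eL; split; [|rewrite eL; lia].
Qed.

(** * Forward chaining *)

Definition body_at (L : seq lrule) (i : nat) : seq nat := (nth rule0 L i).1.
Definition head_at (L : seq lrule) (i : nat) : nat := (nth rule0 L i).2.

Definition unsat (L : seq lrule) (S : nat -> nat) (x : nat) : nat :=
  count (fun i => (head_at L i == x) && (S i == 0)) (iota 0 (size L)).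

(** The order [d] is feasible: each element has its rules satisfied by itself or by earlier
    elements, which makes all prefixes accepted. *)
Definition goodseq (L : seq lrule) (d : seq nat) : Prop :=
  forall i j, i < size L -> j < size d -> head_at L i = nth 0 d j ->
  (head_at L i \in body_at L i) || has [in body_at L i] (take j d).

(* [d] is the queue of all elements added so far, of which the first [h] have
   been removed from it; [c] lists the rules still to be visited for the last
   removed element; [C] and [S] are the counters and the flags. *)
Record core (B : nat) (L : seq lrule) (xs d : seq nat) (h : nat) (c : seq nat)
    (C S : nat -> nat) : Prop := Core {
  core_h : h <= size d;
  core_uniq : uniq d;
  core_sub : {subset d <= xs};
  core_mem : forall x, x < B -> (x \in d) = (x \in xs) && (C x == 0);
  core_unsat : forall x, x < B -> C x = unsat L S x;
  core_good : goodseq L d;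
  core_sound : forall i, i < size L -> S i != 0 ->
    (head_at L i \in body_at L i) || has [in body_at L i] (take h d);
  core_triv : forall i, i < size L -> head_at L i \in body_at L i -> S i != 0;
  core_compl : forall i, i < size L -> has [in body_at L i] (take h d) ->
    (S i != 0) || (i \in c);
  core_c : forall i, i \in c -> i < size L /\ has [in body_at L i] (take h d) }.

Lemma mem_occ L a i : (i \in occ L a) = (i < size L) && (a \in body_at L i).
Proof. by rewrite mem_rev mem_filter mem_iota /= add0n andbC. Qed.

Lemma sub_has_take (P : pred nat) i j (s : seq nat) :
  i <= j -> has P (take i s) -> has P (take j s).
Proof.
move=> le_ij; rewrite -(subnKC le_ij) takeD has_cat => ->; by [].
Qed.

Lemma count_remove (T : eqType) (P P1 : pred T) (s : seq T) x :
  uniq s -> x \in s -> P x -> (forall y, P1 y = P y && (y != x)) ->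
  count P s = (count P1 s).+1.
Proof.
move=> us xs Px P1E; rewrite (permP (perm_to_rem xs)) /= Px add1n; congr _.+1.
rewrite (permP (perm_to_rem xs)) /= P1E eqxx andbF add0n.
apply: eq_in_count => y; rewrite mem_rem_uniq // !inE P1E => /andP [-> _].
by rewrite andbT.
Qed.

(** The rules that may be newly met by the longer prefix are those whose body contains the removed
    element; they become the pending list. *)
Lemma core_pop B L xs d h C S : core B L xs d h [::] C S -> h < size d ->
  core B L xs d h.+1 (occ L (nth 0 d h)) C S.
Proof.
case=> le_h ud sd md us gd so tr co _ lt_h.
split=> // [i lt_i Si|i lt_i|i].
- have /orP [->//|hs] := so i lt_i Si; apply/orP; right.
  exact: sub_has_take hs.
- rewrite (take_nth 0) // has_rcons mem_occ lt_i => /orP [/= -> | hs].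
    by rewrite orbT.
  by have := co i lt_i hs; rewrite orbF => ->.
- rewrite mem_occ (take_nth 0) // has_rcons => /andP [lt_i bi]; split=> //.
  by rewrite /= bi.
Qed.

Lemma core_skip B L xs d h i c C S : core B L xs d h (i :: c) C S -> S i != 0 ->
  core B L xs d h c C S.
Proof.
case=> le_h ud sd md us gd so tr co cc Si; split=> // [j lt_j hj|j jc].
  have := co j lt_j hj; rewrite inE => /orP [->//|/orP [/eqP->|->]].
    by rewrite Si.
  by rewrite orbT.
by apply: cc; rewrite inE jc orbT.
Qed.

(** The body of a pending rule meets the removed prefix, so setting its flag is sound. Its head is
    queued exactly when this was its last unsatisfied rule and it lies in X. *)
Lemma core_visit B L xs d h i c C S : core B L xs d h (i :: c) C S -> S i = 0 ->
  head_at L i < B ->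
  let q := head_at L i in
  core B L xs (if (C q - 1 == 0) && (q \in xs) then rcons d q else d) h c
    (upd C q (C q - 1)) (upd S i 1).
Proof.
case=> le_h ud sd md us gd so tr co cc Si qB q.
have [lt_i hi] := cc i (mem_head _ _).
have cntS : unsat L S q = (unsat L (upd S i 1) q).+1.
  apply: (@count_remove _ _ _ _ i); rewrite ?iota_uniq ?mem_iota ?eqxx ?Si //.
  by move=> j; rewrite /upd; case: (j == i); rewrite ?andbF ?andbT.
have cntS' x : x != q -> unsat L (upd S i 1) x = unsat L S x.
  move=> xq; apply: eq_in_count => j _; rewrite /upd; case: (eqVneq j i) => // ->.
  by rewrite -/q eq_sym (negbTE xq).
have C1 x : x < B -> upd C q (C q - 1) x = unsat L (upd S i 1) x.
  move=> xB; rewrite {1}/upd; case: eqP => [->|/eqP xq].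
    by rewrite us // -/q cntS subn1.
  by rewrite us // cntS'.
(* Rule [i] itself still counted for [q], so [q] was not yet queued and no repetition arises. *)
have qd : q \notin d by rewrite md // us // cntS andbF.
set d1 := if _ then _ else _.
have take1 k : k <= size d -> take k d1 = take k d.
  by move=> le_k; rewrite /d1; case: ifP => // _; rewrite -cats1 takel_cat.
have nth1 k : k < size d -> nth 0 d1 k = nth 0 d k.
  by move=> lt_k; rewrite /d1; case: ifP => // _; rewrite nth_rcons lt_k.
have S1 j : j < size L -> upd S i 1 j != 0 ->
    (head_at L j \in body_at L j) || has [in body_at L j] (take h d).
  move=> lt_j; rewrite /upd; case: (eqVneq j i) => [->|_ Sj]; last exact: so.
  by rewrite hi orbT.
split=> [||x|x xB|x xB|j k lt_j lt_k hj|j lt_j Sj|j lt_j tj|j lt_j|j jc].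
- by rewrite /d1; case: ifP; rewrite ?size_rcons // leqW.
- by rewrite /d1; case: ifP; rewrite ?rcons_uniq ?qd.
- rewrite /d1; case: ifP => [/andP [_ qx]|_]; last exact: sd.
  by rewrite mem_rcons inE => /orP [/eqP->//|]; apply: sd.
- rewrite /d1 /upd; case: (eqVneq x q) => [-> | xq].
    by case: ifP => [/andP [-> ->]|]; rewrite ?mem_rcons ?mem_head // andbC => ->;
      apply/negbTE.
  by case: ifP => _; rewrite ?mem_rcons ?inE ?(negbTE xq) md.
- exact: C1.
(* Only a newly appended last element needs an argument: its counter is 0, so all its rules are
   flagged, and soundness of the flags applies. *)
- have [lt_kd|ge_k] := ltnP k (size d).
    by rewrite nth1 // in hj; rewrite take1 ?(ltnW lt_kd) //; apply: gd.
  move: lt_k hj; rewrite /d1; case: ifP => [/andP [c0 _]|_]; last by lia.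
  rewrite size_rcons => lt_k; have -> : k = size d by lia.
  rewrite nth_rcons ltnn eqxx -cats1 take_size_cat // => hj.
  have Sj : upd S i 1 j != 0.
    have := C1 q qB; rewrite {1}/upd eqxx (eqP c0) => /esym/eqP.
    rewrite eqn0Ngt -has_count -all_predC => /allP /(_ j).
    by rewrite mem_iota /= add0n hj eqxx /= => ->.
  have /orP [->//|hs] := S1 j lt_j Sj.
  by rewrite -(take_size d) (sub_has_take le_h hs) orbT.
- by rewrite take1 //; apply: S1.
- by rewrite /upd; case: (eqVneq j i) => // _; apply: tr.
- rewrite take1 // => hj; have := co j lt_j hj.
  by rewrite inE /upd; case: (eqVneq j i).
- by rewrite take1 //; apply: cc; rewrite inE jc orbT.
Qed.

(** Before any removal only rules whose head lies in their body are satisfied. *)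
Lemma core_init B L xs (C S : nat -> nat) :
  uniq xs -> all (fun x => x < B) xs -> size L <= B ->
  (forall x, x < B ->
    C x = count (fun r : lrule => (r.2 == x) && (r.2 \notin r.1)) L) ->
  (forall i, i < B -> S i = (head_at L i \in body_at L i)) ->
  core B L xs [seq x <- xs | C x == 0] 0 [::] C S.
Proof.
move=> uxs xB LB hC hS.
have hC1 x : x < B -> C x = unsat L S x.
  move=> lt_x; rewrite hC // -{1}(mkseq_nth rule0 L) /mkseq count_map.
  apply: eq_in_count => i; rewrite mem_iota /= add0n => lt_i.
  by rewrite hS ?(leq_trans lt_i) // -/(head_at L i) -/(body_at L i) eqb0.
split=> //; first by rewrite filter_uniq.
- by move=> x; rewrite mem_filter => /andP [].
- by move=> x _; rewrite mem_filter andbC.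
- move=> i j lt_i lt_j hj.
  have := mem_nth 0 lt_j; rewrite -hj mem_filter => /andP [c0 hx].
  have hB := allP xB _ hx.
  move: c0; rewrite hC1 // eqn0Ngt -has_count -all_predC => /allP /(_ i).
  rewrite mem_iota /= add0n eqxx lt_i hS ?(leq_trans lt_i) //.
  by case: (head_at L i \in body_at L i) => // /(_ isT).
- by move=> i lt_i; rewrite hS ?(leq_trans lt_i) // eqb0 negbK => ->.
- by move=> i lt_i; rewrite hS ?(leq_trans lt_i) // => ->.
- by move=> i _; rewrite take0.
Qed.

Lemma size_occ_rcons L r a :
  size (occ (rcons L r) a) = size (occ L a) + (a \in r.1).
Proof. by rewrite occ_rcons; case: ifP; rewrite ?addn1 ?addn0. Qed.

(** Double counting of occurrences, rule by rule: distinct elements of [xs] in one body number at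
    most its size. This makes all list traversals together linear. *)
Lemma sum_occ_le L xs : uniq xs ->
  \sum_(a <- xs) size (occ L a) <= \sum_(r <- L) size r.1.
Proof.
move=> uxs; elim/last_ind: L => [|L r IH]; first by rewrite big1.
rewrite (eq_bigr _ (fun a _ => size_occ_rcons L r a)) big_split /=.
rewrite -cats1 big_cat big_seq1 leq_add //.
rewrite -[X in X <= _]/(\sum_(a <- xs) (if a \in r.1 then 1 else 0)).
rewrite -big_mkcond sum1_count -size_filter uniq_leq_size ?filter_uniq // => a.
by rewrite mem_filter => /andP [].
Qed.

Lemma sum_uniq_sub (s t : seq nat) (f : nat -> nat) :
  uniq s -> {subset s <= t} -> \sum_(a <- s) f a <= \sum_(a <- t) f a.
Proof.
elim: s t => [|x s IH] t; first by rewrite big_nil.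
case/andP=> xs us st; have xt := st x (mem_head _ _).
rewrite big_cons (perm_big _ (perm_to_rem xt)) big_cons leq_add2l.
apply: IH => // y ys; have yx : y != x by apply: contraNneq xs => <-.
have := st y; rewrite inE ys orbT (perm_mem (perm_to_rem xt)) inE (negbTE yx).
exact.
Qed.

(** * Reading the subset and saturating the queue *)

Definition read_elem : com aop :=
  block [:: Op (ALoad 10 1 7); Op (AAdd 7 7 0); Op (AStore 8 10 0);
            Op (ALoad 11 2 10);
            If 11 Skip (block [:: Op (AStore 9 1 10); Op (AAdd 1 1 0)]);
            Op (ASub 8 8 0)].

Definition read_set : com aop :=
  block [:: Op (ALoad 15 1 7); Op (AAdd 7 7 0); Op (AConst 8 0); Op (AAdd 8 8 15);
            Op (AConst 1 0); While 8 read_elem].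

Definition tables_eq (A A1 : nat -> nat -> nat) : Prop :=
  forall k, k <= 7 -> A1 k = A k.

Definition queue (B : nat) (xs d : seq nat) (s : ast) : Prop :=
  [/\ s.1 1 = size d, forall j, j < size d -> s.2 9 j = nth 0 d j
    & forall x, x < B -> s.2 8 x = (x \in xs)].

Lemma read_set_spec B W xs s :
  s.2 1 = W -> (forall x, x < B -> s.2 8 x = 0) -> s.1 0 = 1 ->
  input_at B W (s.1 7) (size xs :: xs) -> uniq xs -> all (fun x => x < B) xs ->
  vc (l := arrm B) read_set s (fun s1 t =>
    [/\ tables_eq s.2 s1.2, s1.1 0 = 1, s1.1 2 = s.1 2 /\ s1.1 15 = size xs,
        queue B xs [seq x <- xs | s.2 2 x == 0] s1
      & t <= 12 * size xs + 6]).
Proof.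
case: s => R A /= eW M0 r0 /input_at_cons [pB Wp inp] uxs xsB.
rewrite /read_set; step; rewrite eW Wp; step; rewrite r0 addn1; do 3!step.
rewrite add0n.
pose I f (s : ast) := exists l1 l2, [/\ l1 ++ l2 = xs, f = 12 * size l2,
  tables_eq A s.2,
  [/\ s.1 0 = 1, s.1 2 = R 2, s.1 8 = size l2, s.1 15 = size xs
    & input_at B W (s.1 7) l2]
  & queue B l1 [seq x <- l1 | A 2 x == 0] s].
apply: (@vc_while (arrm B) I _ _ _ _ (12 * size xs)).
- move=> f [r T] [l1 [[|a l2] [el ef tT [s0 s2 s8 s15 inps] [q1 q9 q8]]]] /= nz;
    rewrite /= in tT s0 s2 s8 s15 inps q1 q9 q8; first by case: nz.
  case/input_at_cons: inps => paB Wa inp2.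
  have aB : a < B by move: xsB; rewrite -el all_cat => /andP [_ /andP []].
  have T1 : T 1 = W by rewrite tT.
  have T2 j v : updA T 8 j v 2 = A 2 by apply: (tT 2).
  have lt_d : size [seq x <- l1 | A 2 x == 0] < B.
    have := inp.1; rewrite -el size_cat /= size_filter.
    by have := count_size (fun x => A 2 x == 0) l1; lia.
  rewrite /read_elem; step; rewrite T1 Wa; step; rewrite s0 addn1; step; step.
  rewrite T2 s0.
  have mem_q8 x : x < B -> upd (T 8) a 1 x = (x \in rcons l1 a).
    move=> xB; rewrite /upd mem_rcons inE; case: (x == a) => //=.
    exact: q8.
  apply: vc_if => /= Ca.
    do 2!step; apply: vc_skip; step; apply: vc_skip => /=.
    exists (12 * size l2); last by rewrite ef /=; lia.
    exists (rcons l1 a), l2; split=> //; first by rewrite cat_rcons.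
    + by move=> k; have := tT k; rewrite /updA; case: k => [|[|[|[|[|[|[|[|]]]]]]]].
    + by rewrite /= s0 s8 subn1.
    rewrite /queue /= s0 filter_rcons Ca eqxx size_rcons q1 addn1; split=> //.
    move=> j lt_j; rewrite /updA /= /upd nth_rcons.
    by move: lt_j; rewrite ltnS; case: ltngtP => // lt_j _; apply: q9.
  apply: vc_skip; step; apply: vc_skip => /=.
  exists (12 * size l2); last by rewrite ef /=; lia.
  exists (rcons l1 a), l2; split=> //; first by rewrite cat_rcons.
  + by move=> k; have := tT k; rewrite /updA; case: k => [|[|[|[|[|[|[|[|]]]]]]]].
  + by rewrite /= s0 s8 subn1.
  by rewrite /queue /= filter_rcons; case: eqP Ca => // _ _; split.
- exists [::], xs; split=> //.
move=> f s t [l1 [[|a l2] [el ef tT [s0 s2 s8 s15 inps] q]]] /=; last by rewrite s8.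
rewrite cats0 in el; rewrite el in q => _ le_t.
by apply: vc_skip; split=> //; lia.
Qed.

Definition visit : com aop :=
  block [:: Op (ALoad 3 5 13); Op (ALoad 13 4 13); Op (ALoad 11 6 3);
    If 11 Skip (block [::
      Op (AStore 6 3 0); Op (ALoad 9 7 3); Op (ALoad 11 2 9); Op (ASub 11 11 0);
      Op (AStore 2 9 11);
      If 11 Skip (block [::
        Op (ALoad 11 8 9);
        If 11 (block [:: Op (AStore 9 1 9); Op (AAdd 1 1 0)]) Skip])])].

Definition pop : com aop :=
  block [:: Op (ALoad 10 9 12); Op (AAdd 12 12 0); Op (ALoad 13 3 10)].

(** The guard in register 14 adds the number of waiting elements and the current cell, so it
    vanishes only when queue and list are both exhausted. *)
Definition chase : com aop :=
  block [:: If 13 visit pop; Op (ASub 14 1 12); Op (AAdd 14 14 13)].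

(** Register 0 already holds 1, the positive answer; it is cleared if fewer elements were queued
    than X has. *)
Definition saturate : com aop :=
  block [:: Op (AConst 12 0); Op (AConst 13 0); Op (AAdd 14 1 12);
            While 14 chase;
            Op (ASub 11 15 1); If 11 (block [:: Op (AConst 0 0)]) Skip].

(** One unit for the removal from the queue and one for each visited rule. *)
Definition weight (L : seq lrule) (a : nat) : nat := (size (occ L a)).+1.

(* The potential of the main loop: rules still to be visited, plus the weights
   of the elements of X not yet removed from the queue. *)
Definition potential (L : seq lrule) (xs d : seq nat) (h : nat) (c : seq nat) :=
  24 * (size c + (\sum_(a <- xs) weight L a - \sum_(a <- take h d) weight L a)).

Record running (B e : nat) (L : seq lrule) (xs d : seq nat) (h : nat)
    (c : seq nat) (s : ast) : Prop := Running {
  run_core : core B L xs d h c (s.2 2) (s.2 6);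
  run_queue : queue B xs d s;
  run_heads : forall i, i < B -> s.2 7 i = head_at L i;
  run_lists : forall a, a < B -> chain e (s.2 4) (s.2 5) (s.2 3 a) (occ L a);
  run_chain : chain e (s.2 4) (s.2 5) (s.1 13) c;
  run_one : s.1 0 = 1;
  run_h : s.1 12 = h;
  run_size : s.1 15 = size xs }.

Lemma visit_spec B e L xs d h i c s :
  running B e L xs d h (i :: c) s -> e < B -> size L <= B -> size xs <= B ->
  rules_ok B L ->
  vc (l := arrm B) visit s (fun s1 t => exists d1,
    [/\ running B e L xs d1 h c s1, take h d1 = take h d & t <= 18]).
Proof.
case: s => R A [/= co [q1 q9 q8] hh hl /= hc r0 r12 r15] eB LB xB okL.
rewrite /= in q1 q9 q8 hh hl.
case: hc => /andP [r13 le13] A5 hc.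
have [lt_i _] := core_c co (mem_head i c).
have qB : head_at L i < B.
  by have := allP okL _ (mem_nth rule0 lt_i) => /and3P [].
have iB := leq_trans lt_i LB.
have uC : A 2 (head_at L i) = unsat L (A 6) (head_at L i) by rewrite (core_unsat co).
rewrite /visit; step; rewrite A5; step; step; apply: vc_if => /= Si.
  have := core_visit co Si qB; rewrite /=.
  set q := head_at L i in qB uC *; set d1 := if _ then _ else _.
  move=> /= co1.
  have tk : take h d1 = take h d.
    rewrite /d1; case: ifP => // _; rewrite -cats1 takel_cat //; exact: core_h co.
  have A7 : updA A 6 i 1 7 i = q by apply: hh.
  have A2 : updA A 6 i 1 2 q = A 2 q by [].
  step; rewrite r0; step; rewrite A7; step; rewrite A2; step; rewrite r0; step.
  have A8 v : updA (updA A 6 i 1) 2 q v 8 q = (q \in xs) by apply: q8.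
  apply: vc_if => /= Cq.
    step; rewrite A8; apply: vc_if => /= qx.
      do 3!apply: vc_skip; exists d1; split=> //=.
      have ed : d1 = d by rewrite /d1; case: (q \in xs) qx => //; rewrite andbF.
      by rewrite ed in co1 *; split.
    have qxs : q \in xs by case: (q \in xs) qx.
    have ed : d1 = rcons d q by rewrite /d1 Cq qxs.
    (* The extended queue has no repetition and stays inside X, so the store is within bounds. *)
    have lt_d : size d < B.
      apply: leq_trans xB; rewrite -(size_rcons d q) -ed.
      exact: uniq_leq_size (core_uniq co1) (core_sub co1).
    rewrite -q1 in lt_d.
    do 2!step; do 3!apply: vc_skip; exists d1; split=> //=.
    rewrite ed in co1 *; split=> //.
    rewrite /queue /= r0 size_rcons q1 addn1; split=> // j.
    rewrite /updA /= /upd nth_rcons ltnS.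
    by case: ltngtP => // lt_j _; apply: q9.
  do 3!apply: vc_skip; exists d1; split=> //=.
  have ed : d1 = d by rewrite /d1; case: eqP Cq.
  by rewrite ed in co1 *; split.
do 2!apply: vc_skip; exists d; split=> //.
by split=> //; apply: core_skip co _; apply/eqP.
Qed.

Lemma pop_spec B e L xs d h s : running B e L xs d h [::] s -> h < size d ->
  size d <= B -> all (fun x => x < B) xs ->
  vc (l := arrm B) pop s (fun s1 t =>
    running B e L xs d h.+1 (occ L (nth 0 d h)) s1 /\ t <= 3).
Proof.
case: s => R A [/= co [q1 q9 q8] hh hl /= hc r0 r12 r15] lt_h dB xsB.
rewrite /= in q1 q9 q8 hh hl.
have aB : nth 0 d h < B by apply: (allP xsB); apply: (core_sub co); apply: mem_nth.
rewrite /pop; step; rewrite r12 q9 //; step; rewrite r0 addn1; step.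
apply: vc_skip; split=> //; split=> //=.
- exact: core_pop co lt_h.
- exact: hl.
by rewrite r12.
Qed.

Lemma saturate_spec B e L xs s :
  tables B L e s.2 -> queue B xs [seq x <- xs | s.2 2 x == 0] s ->
  s.1 0 = 1 -> s.1 15 = size xs -> e < B -> size L <= B -> size xs <= B ->
  rules_ok B L -> uniq xs -> all (fun x => x < B) xs ->
  vc (l := arrm B) saturate s (fun s1 t => exists d C S,
    [/\ core B L xs d (size d) [::] C S, s1.1 0 = (size xs <= size d)
      & t <= 24 * \sum_(a <- xs) weight L a + 10]).
Proof.
case: s => R A /= [h2 h6 h7 hc] q r0 r15 eB LB xB okL uxs xsB.
rewrite /saturate; do 3!step.
have hR1 : R 1 = size [seq x <- xs | A 2 x == 0] by case: q.
set d0 := [seq x <- xs | A 2 x == 0] in q hR1.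
pose I f (s : ast) := exists d h c, [/\ running B e L xs d h c s,
  f = potential L xs d h c & s.1 14 = size d - h + s.1 13].
apply: (@vc_while (arrm B) I _ _ _ _ (potential L xs d0 0 [::])).
- move=> f s [d [h [c [run -> s14]]]] nz.
  have dB : size d <= B.
    have co := run_core run; apply: leq_trans xB.
    exact: uniq_leq_size (core_uniq co) (core_sub co).
  rewrite /chase; apply: vc_if => /= r13.
    have c0 : c = [::].
      by have := run_chain run; rewrite r13; case: (c) => //= ? ? [].
    rewrite c0 in run *.
    have lt_h : h < size d by move: nz; rewrite /= s14 r13; lia.
    apply: vc_mono (pop_spec run lt_h dB xsB) _ => s1 t [run1 le_t].
    have [[s11 _ _] s112] := (run_queue run1, run_h run1).
    case: s1 run1 s11 s112 => R1 A1 /= run1 s11 s112.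
    do 2!step; apply: vc_skip => /=.
    exists (potential L xs d h.+1 (occ L (nth 0 d h))).
      exists d, h.+1, (occ L (nth 0 d h)); split=> //.
        by case: run1.
      by rewrite /= s11 s112.
    (* The removed elements, the new one included, are distinct members of X, so the difference in
       the potential is not truncated and releases the weight of the new one. *)
    have le_w := sum_uniq_sub (weight L) (take_uniq h.+1 (core_uniq (run_core run)))
      (fun a ha => core_sub (run_core run) (mem_take ha)).
    rewrite /potential; move: le_w.
    rewrite (take_nth 0) // -cats1 big_cat big_seq1 /=.
    by have -> : weight L (nth 0 d h) = (size (occ L (nth 0 d h))).+1 by []; lia.
  case: c run s14 => [|i c] run s14; first by have /= := run_chain run.
  apply: vc_mono (visit_spec run eB LB xB okL) _ => s1 t [d1 [run1 tk le_t]].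
  have [[s11 _ _] s112] := (run_queue run1, run_h run1).
  case: s1 run1 s11 s112 => R1 A1 /= run1 s11 s112.
  do 2!step; apply: vc_skip => /=.
  exists (potential L xs d1 h c).
    exists d1, h, c; split=> //.
      by case: run1.
    by rewrite /= s11 s112.
  (* The factor 24 is tight here: 18 for the visit, 2 for the branch, 2 for the guard and 2 for the
     loop. *)
  by rewrite /potential tk /=; lia.
- exists d0, 0, [::]; split=> //.
    split=> //.
    exact: (core_init (S := A 6) uxs xsB LB h2 h6).
  by rewrite /= hR1; lia.
move=> f s t [d [h [c [run _ s14]]]] /= z le_t.
have c0 : c = [::].
  have /= := run_chain run; have -> : s.1 13 = 0 by lia.
  by case: (c) => //= ? ? [].
have eh : h = size d by have := core_h (run_core run); lia.
rewrite c0 eh in run.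
have [s11 _ _] := run_queue run.
have le_t1 : t <= 24 * \sum_(a <- xs) weight L a + 1.
  by move: le_t; rewrite /potential take0 big_nil /=; lia.
case: s run s11 z s14 => R1 A1 run /= s11 z s14.
have /= r15' := run_size run; have /= r0' := run_one run.
step; rewrite r15' s11; apply: vc_if => /= le_x.
  do 2!apply: vc_skip; exists d, (A1 2), (A1 6); split; [by case: run | | by lia].
  by rewrite /= r0'; lia.
step; do 2!apply: vc_skip; exists d, (A1 2), (A1 6); split; [by case: run | | by lia].
by rewrite /=; lia.
Qed.

(** * Antimatroids and the encoding *)

Definition lrule_of n (r : rule n) : lrule := (enc_set r.1, val r.2).

Lemma mem_enc_set n (A : {set 'I_n}) (i : 'I_n) : (val i \in enc_set A) = (i \in A).
Proof. by rewrite mem_map ?mem_enum //; apply: val_inj. Qed.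

Lemma enc_set_uniq n (A : {set 'I_n}) : uniq (enc_set A).
Proof. by rewrite map_inj_uniq ?enum_uniq //; apply: val_inj. Qed.

Lemma enc_setP n (A : {set 'I_n}) x :
  reflect (exists2 i : 'I_n, i \in A & x = val i) (x \in enc_set A).
Proof.
apply: (iffP mapP) => [[i iA ->]|[i iA ->]].
  by rewrite mem_enum in iA; exists i.
by exists i; rewrite ?mem_enum.
Qed.

Lemma enc_set_lt n (A : {set 'I_n}) : all (fun x => x < n) (enc_set A).
Proof. by apply/allP => x /enc_setP [i _ ->]; apply: ltn_ord. Qed.

Lemma size_enc_set n (A : {set 'I_n}) : size (enc_set A) = #|A|.
Proof. by rewrite size_map cardE. Qed.

Lemma encodeE n (R : seq (rule n)) X : encode R X =
  n :: size (map (@lrule_of n) R) ::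
    rules_enc (map (@lrule_of n) R) ++ size (enc_set X) :: enc_set X.
Proof.
rewrite /encode /rules_enc size_map size_enc_set -map_comp; congr [:: _, _ & _ ++ _].
congr flatten; apply: eq_map => r.
by rewrite /enc_rule /= /lrule_enc /= size_enc_set.
Qed.

Lemma lsize_cons n (r : rule n) R : lsize (r :: R) = #|r.1| + 1 + lsize R.
Proof. by rewrite /lsize big_cons. Qed.

Lemma size_le_lsize n (R : seq (rule n)) : size R <= lsize R.
Proof. by elim: R => //= r R IH; rewrite lsize_cons; lia. Qed.

Lemma size_rules_enc n (R : seq (rule n)) :
  size (rules_enc (map (@lrule_of n) R)) = lsize R + size R.
Proof.
elim: R => [|r R IH]; first by rewrite /lsize big_nil.
rewrite lsize_cons -[rules_enc _]/(lrule_enc (lrule_of r) ++ rules_enc (map _ R)).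
by rewrite size_cat IH /= size_enc_set; move: #|r.1| (lsize R) => a b; lia.
Qed.

(** The upper bound makes time linear in the encoding linear in [lsize R]; the lower one puts all
    elements of the ground set below the stride. *)
Lemma size_encode n (R : seq (rule n)) X : n <= lsize R ->
  n + 3 <= size (encode R X) <= 3 * lsize R + 3.
Proof.
move=> le_n; rewrite encodeE /= size_cat /= size_rules_enc size_enc_set.
by have := max_card X; have := size_le_lsize R; rewrite card_ord; lia.
Qed.

Lemma count0_enc_set n (A : {set 'I_n}) : count (pred1 0) (enc_set A) <= 1.
Proof. by rewrite count_uniq_mem ?enc_set_uniq // leq_b1. Qed.

(** Each rule contributes at most three zeros: its body size, its head and the element 0 of its
    body. The other four may be [n], the number of rules, the size of X and its element 0. *)
Lemma count0_encode n (R : seq (rule n)) X :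
  count (pred1 0) (encode R X) <= 3 * size R + 4.
Proof.
have le_rules : count (pred1 0) (rules_enc (map (@lrule_of n) R)) <= 3 * size R.
  elim: R => // r R IH.
  rewrite -[rules_enc _]/(lrule_enc (lrule_of r) ++ rules_enc (map _ R)).
  rewrite count_cat mulnS leq_add // /=.
  exact: (leq_add (leq_b1 _) (leq_add (leq_b1 _) (count0_enc_set _))).
rewrite encodeE /= count_cat /=; have := count0_enc_set X; move: le_rules.
move: (count _ (rules_enc _)) (count _ (enc_set X)) => a b.
by do 3!case: (_ == 0) => /=; lia.
Qed.

Lemma encode_le n (R : seq (rule n)) X j : n <= lsize R ->
  nth 0 (encode R X) j <= lsize R.
Proof.
move=> le_n; suff /all_nthP h : all (fun x => x <= lsize R) (encode R X).
  by have [/h|/(nth_default 0) ->] := ltnP j (size (encode R X)).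
have set_le (A : {set 'I_n}) : all (fun x => x <= lsize R) (enc_set A).
  by apply: sub_all (enc_set_lt A) => x lt_x; apply: leq_trans (ltnW lt_x) le_n.
have card_le (A : {set 'I_n}) : size (enc_set A) <= lsize R.
  by rewrite size_enc_set; apply: leq_trans (max_card A) _; rewrite card_ord.
rewrite encodeE /= all_cat /= size_map le_n size_le_lsize card_le set_le !andbT /=.
apply/allP => x /flattenP [l /mapP [_ /mapP [r _ ->] ->]].
move: x; apply/allP; rewrite /= card_le set_le andbT /=.
exact: leq_trans (ltnW (ltn_ord _)) le_n.
Qed.

Lemma rules_ok_of n B (R : seq (rule n)) : n <= B ->
  rules_ok B (map (@lrule_of n) R).
Proof.
move=> le_n; apply/allP => _ /mapP [r _ ->] /=.
rewrite enc_set_uniq (leq_trans (ltn_ord _) le_n) /=.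
by apply: sub_all (enc_set_lt _) => x lt_x; apply: leq_trans lt_x le_n.
Qed.

(** * From the final queue to tight paths *)

Definition set_of n (d : seq nat) : {set 'I_n} := [set i | val i \in d].

Lemma body_ofE n (R : seq (rule n)) r0 i : i < size R ->
  body_at (map (@lrule_of n) R) i = enc_set (nth r0 R i).1.
Proof. by move=> lt_i; rewrite /body_at (nth_map r0). Qed.

Lemma head_ofE n (R : seq (rule n)) r0 i : i < size R ->
  head_at (map (@lrule_of n) R) i = val (nth r0 R i).2.
Proof. by move=> lt_i; rewrite /head_at (nth_map r0). Qed.

Lemma inK_goodseq n (R : seq (rule n)) d k :
  goodseq (map (@lrule_of n) R) d -> inK R (set_of n (take k d)).
Proof.
move=> gd; apply/allP => r rR; apply/implyP; rewrite inE => hq.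
have lt_i : index r R < size R by rewrite index_mem.
have hn : nth r R (index r R) = r by rewrite nth_index.
have lt_j : index (val r.2) (take k d) < size (take k d) by rewrite index_mem.
set j := index _ _ in lt_j.
have lt_jd : j < size d by apply: leq_trans lt_j _; rewrite size_take_min geq_minr.
have lt_jk : j < k by apply: leq_trans lt_j _; rewrite size_take_min geq_minl.
have hj : nth 0 d j = val r.2 by rewrite -(nth_take 0 lt_jk) nth_index.
have := gd (index r R) j; rewrite size_map (body_ofE r) // (head_ofE r) // hn hj.
move=> /(_ lt_i lt_jd erefl) /orP [hb|/hasP [x xj /enc_setP [i ir ex]]].
  by apply/set0Pn; exists r.2; rewrite !inE hq -mem_enc_set.
apply/set0Pn; exists i; rewrite !inE ir andbT -ex.
by rewrite -(take_takel d (ltnW lt_jk)) in xj; apply: mem_take xj.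
Qed.

(** The prefixes of [d] form the path. *)
Lemma goodseq_tight_path n (R : seq (rule n)) d :
  goodseq (map (@lrule_of n) R) d -> uniq d -> all (fun x => x < n) d ->
  tight_path_to R (set_of n d).
Proof.
move=> gd ud dn; rewrite -{1}(take_size d).
elim: {-2}(size d) (leqnn (size d)) => [_|k IH lt_k].
  exists [::]; split=> //=; last by rewrite take0; apply/setP => i; rewrite !inE.
  by apply/allP => r _; rewrite /accepts inE.
have [s [k0 ks ps ls]] := IH (ltnW lt_k).
exists (rcons s (set_of n (take k.+1 d))); split=> //.
- by rewrite all_rcons ks andbT; apply: inK_goodseq.
- rewrite rcons_path ps ls /= /tight_step (take_nth 0) //; apply/andP; split.
    by apply/subsetP => i; rewrite !inE mem_rcons inE orbC => ->.
  have xn : nth 0 d k < n by apply: (allP dn); rewrite mem_nth.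
  apply/cards1P; exists (Ordinal xn); apply/setP => i.
  rewrite !inE mem_rcons inE -val_eqE /=.
  case: eqP => [->|_] /=; last by rewrite andNb.
  move: ud; rewrite -{1}(cat_take_drop k d) cat_uniq => /and3P [_ /hasPn h _].
  by rewrite andbT; apply: h; rewrite (drop_nth 0) // mem_head.
- by rewrite last_rcons.
Qed.

Lemma path_tight_sub n (s : seq {set 'I_n}) Y :
  path (@tight_step n) Y s -> Y \subset last Y s.
Proof.
elim: s Y => //= Z s IH Y /andP [/andP [YZ _] /IH]; exact: subset_trans.
Qed.

(** Maximality of the greedy result, by induction along the path. If a step from a set inside [d]
    added some [z] outside [d], then [z] would have an unsatisfied rule, although the next set is
    accepted by it. *)
Lemma tight_path_in_core n (R : seq (rule n)) X B d C S :
  n <= B ->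
  core B (map (@lrule_of n) R) (enc_set X) d (size d) [::] C S ->
  tight_path_to R X -> X \subset set_of n d.
Proof.
move=> nB co [s [_ ks ps ls]].
have : set0 \subset set_of n d by apply: sub0set.
elim: s (set0 : {set 'I_n}) ks ps ls => [|Z s IH] Y /=; first by move=> _ _ ->.
move=> /andP [kZ ks] /andP [tZ ps] ls Yd.
apply: (IH Z) => //; apply/subsetP => z zZ; rewrite inE; apply: contraT => zd.
have zX : z \in X by rewrite -ls; apply: subsetP (path_tight_sub ps) _ zZ.
have zB : val z < B by exact: leq_trans (ltn_ord z) nB.
(* The step adds a single element, and this must be [z]. *)
have ZY y : y \in Z -> y != z -> y \in Y.
  case/andP: tZ => YZ /cards1P [x ZYx] yZ; apply: contraR => yY.
  have : y \in [set x] by rewrite -ZYx inE yY.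
  rewrite inE => /eqP ->; have : z \in [set x].
    rewrite -ZYx inE zZ andbT; apply: contra zd => zY.
    by have := subsetP Yd z zY; rewrite inE.
  by rewrite inE eq_sym.
(* As [z] is in X but not queued, its counter is positive and yields an unflagged rule [i] with head
   [z]. *)
move: (core_mem co zB); rewrite (negbTE zd) mem_enc_set zX /= (core_unsat co zB).
move=> /esym/negbT; rewrite -lt0n -has_count => /hasP [i].
rewrite mem_iota /= add0n => lt_i /andP [/eqP hz /eqP Si].
have lt_iR : i < size R by rewrite size_map in lt_i.
pose r0 : rule n := (set0, z).
have := allP kZ _ (mem_nth r0 lt_iR); rewrite /accepts.
rewrite (head_ofE r0) // in hz; rewrite (val_inj hz) zZ /= => /set0Pn [y].
rewrite inE => /andP [yZ yr].
(* The common element [y] of body and [Z] is either the head, making the rule satisfied from the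
   start, or an earlier element of [d], making it satisfied after all removals. *)
have [eyz|yz] := eqVneq y z.
  have := core_triv co lt_i; rewrite (head_ofE r0) // hz (body_ofE r0) //.
  by rewrite mem_enc_set -eyz yr Si => /(_ isT).
have := core_compl co lt_i; rewrite take_size Si (body_ofE r0) //.
apply; apply/hasP; exists (val y); last by rewrite /= mem_enc_set.
by have := subsetP Yd y (ZY y yZ yz); rewrite inE.
Qed.

(** The queue lists distinct elements of X, so comparing sizes decides whether it exhausts X. *)
Lemma core_inA n (R : seq (rule n)) X B d C S :
  n <= B ->
  core B (map (@lrule_of n) R) (enc_set X) d (size d) [::] C S ->
  inA R X <-> size (enc_set X) <= size d.
Proof.
move=> nB co; split=> [[_ /(tight_path_in_core nB co) Xd]|le_d].
  apply: uniq_leq_size (enc_set_uniq X) _ => x /enc_setP [i iX ->].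
  by have := subsetP Xd i iX; rewrite inE.
have [_ edX] := uniq_min_size (core_uniq co) (core_sub co) le_d.
have setX : set_of n d = X by apply/setP => i; rewrite inE edX mem_enc_set.
have gd := core_good co; split.
  by have := inK_goodseq (size d) gd; rewrite take_size setX.
rewrite -setX; apply: goodseq_tight_path (core_uniq co) _ => //.
by apply/allP => x /(core_sub co) /enc_setP [i _ ->]; apply: ltn_ord.
Qed.

(** * The decision program and its running time *)

Definition decide : com aop := block [:: parse; read_set; saturate].

Definition decide_program : program := compile 0 (block [:: prelude; cmap decide]).

Lemma decide_spec n (R : seq (rule n)) X B s :
  n <= lsize R -> size (encode R X) < B -> s.1 0 = 1 ->
  (forall j, 0 < j < B -> s.2 1 j = nth 0 (encode R X) j) ->
  (forall k j, 2 <= k <= 8 -> j < B -> s.2 k j = 0) ->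
  vc (l := arrm B) decide s (fun s1 t =>
    (s1.1 0 = 1 <-> inA R X) /\ t <= 82 * lsize R + 22).
Proof.
move=> le_n ltB s0 sW sZ; have szE := size_encode X le_n.
have nB : n <= B by lia.
set xs := enc_set X; pose L := map (@lrule_of n) R.
have wE : encode R X = n :: size L :: rules_enc L ++ size xs :: xs := encodeE R X.
have okL : rules_ok B L := rules_ok_of R nB.
have uxs : uniq xs := enc_set_uniq X.
have xsB : all (fun x => x < B) xs.
  by apply: sub_all (enc_set_lt X) => x lt_x; apply: leq_trans nB.
have le_xs : size xs <= n by have := max_card X; rewrite size_enc_set card_ord.
have szw : size (encode R X) = 2 + size (rules_enc L ++ size xs :: xs) by rewrite wE.
have W1 : s.2 1 1 = size L by rewrite sW ?wE //; lia.
have LB : size L <= B.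
  have := size_le_lsize R; move: szE ltB.
  by rewrite size_map wE /= size_cat size_rules_enc; lia.
rewrite /decide /block /=; apply: vc_seq.
have hW j : 0 < j < B ->
    s.2 1 j = nth 0 (n :: size L :: rules_enc L ++ size xs :: xs) j.
  by move=> hj; rewrite sW // wE.
have sZ7 k j : 2 <= k <= 7 -> j < B -> s.2 k j = 0.
  by move=> hk; apply: sZ; lia.
have le_w : 2 + size (rules_enc L ++ size xs :: xs) <= B by rewrite -szw ltnW.
apply: vc_mono (parse_spec erefl erefl s0 sZ7 okL W1 le_w hW) _.
move=> s1 t1 [[tab [e1 e8] [s10 s13 lt_e] _ inp] le_t1].
have eB : s1.1 2 < B by case: inp => /=; lia.
apply: vc_seq.
have M0 x : x < B -> s1.2 8 x = 0 by rewrite e8; apply: sZ.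
apply: vc_mono (read_set_spec e1 M0 s10 inp uxs xsB) _.
move=> s2 t2 [teq s20 [s22 s215] q le_t2].
apply: vc_seq.
have tab2 : tables B L (s1.1 2) s2.2.
  by case: tab => h2 h6 h7 hc; split; rewrite !teq.
have q2 : queue B xs [seq x <- xs | s2.2 2 x == 0] s2 by rewrite teq.
apply: vc_mono (saturate_spec tab2 q2 s20 s215 eB LB _ okL uxs xsB) _.
  exact: leq_trans le_xs nB.
move=> s3 t3 [d [C [S [co s30 le_t3]]]]; apply: vc_skip; split.
  rewrite (core_inA nB co) s30 -/xs; by case: (_ <= _).
have sum_body : \sum_(r <- L) size r.1 + size R = lsize R.
  rewrite /L big_map /lsize big_split /= sum1_size; congr (_ + _).
  by apply: eq_bigr => r _; rewrite size_enc_set.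
have le_weight : \sum_(a <- xs) weight L a <= \sum_(r <- L) size r.1 + size xs.
  rewrite /weight (eq_bigr (fun a => size (occ L a) + 1)).
    2: by move=> a _; rewrite addn1.
  by rewrite big_split /= sum1_size leq_add2r sum_occ_le.
have parse_timeE : parse_time L = 22 * \sum_(r <- L) size r.1 + 20 * size R.
  rewrite /parse_time big_split /= -big_distrr /= big_const_seq count_predT.
  by rewrite iter_addn_0 size_map.
(* Body elements cost 22 + 24, rules 20 and elements of X 12 + 24; as X has at most [lsize R]
   elements, 46 + 36 gives 82. *)
move: le_t1 le_t2 le_t3 le_weight sum_body; rewrite parse_timeE.
move: (\sum_(r <- L) _) (\sum_(a <- xs) _) => a b; lia.
Qed.

(* There is a RAM program p and a constant c such that for every finite
   ground set Q = 'I_n, every (finite) set of rules R (listed as a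
   sequence) with l(R) >= |Q|, and every X ⊆ Q, p on the encoding of
   (Q, R, X) halts within c * l(R) + c steps and answers
   whether X ∈ A(R). *)
Theorem theorem1p2 :
  exists (p : program) (c : nat),
    forall (n : nat) (R : seq (rule n)) (X : {set 'I_n}),
      n <= lsize R ->
      exists k, k <= c * lsize R + c /\
        forall b : bool, (b <-> inA R X) -> runs_in p (encode R X) k b.
Proof.
(* The prelude costs at most [138 * lsize R + 436], the rest 12 times [82 * lsize R + 22]; 1200
   covers both coefficients of the sum. *)
exists decide_program, 1200 => n R X le_n.
set w := encode R X.
have w1 : nth 0 w 1 = size R by [].
have hz : count (pred1 0) w <= 3 * nth 0 w 1 + 4 by rewrite w1 count0_encode.
have hV j : nth 0 w j <= lsize R by apply: encode_le.
have [m [t [e1 [B [[B32 ltB] [m0 m4] mW mZ le_t]]]]] := prelude_spec hV hz.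
(* The memory left by the prelude, read as registers and arrays, is represented by itself. *)
pose s : ast := (m, fun k j => m (k * B + j)).
have rep_s : rep B s m by [].
have sW j : 0 < j < B -> s.2 1 j = nth 0 w j by move=> hj; rewrite /= mul1n mW.
have sZ k j : 2 <= k <= 8 -> j < B -> s.2 k j = 0.
  by move=> hk _; rewrite /= mZ //; nia.
have /vc_wp [s1 [t1 [e2 [ans le_t1]]]] := decide_spec (s := s) le_n ltB m0 sW sZ.
have [//|m1 [t2 [e3 rep1 le_t2]]] := cmap_spec B32 e2 _ rep_s.
have e : ev (l := ram) (block [:: prelude; cmap decide]) (nth 0 w) m1 (t + (t2 + 0)).
  apply: ev_seq e1 _; apply: ev_seq e3 _; exact: ev_skip.
have [hlt memE] := compile_halts e.
exists (t + (t2 + 0)); split.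
  by have := size_encode X le_n; rewrite -/w; lia.
move=> b hb; split; first exact: hlt.
rewrite memE (rep_reg rep1) //; apply/eqP/idP => [/ans/hb //|/hb/ans //].
Qed.
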